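(* Let $\mathcal{H}_A,\mathcal{H}_B$ be complex Hilbert spaces of finite dimensions $d_A,d_B$, and let $d=d_Ad_B\ge 2$. Let $p_1=1$ and let $p_2,p_3$ be real numbers with $$\frac1d\le p_2\le 1,\qquad \alpha x^3+(1-\alpha x)^3\le p_3\le [1-(d-1)y]^3+(d-1)y^3,$$ where $\alpha=\lfloor 1/p_2\rfloor$, $x=\frac{\alpha+\sqrt{\alpha[p_2(\alpha+1)-1]}}{\alpha(\alpha+1)}$ and $y=\frac{d-1-\sqrt{(d-1)(p_2d-1)}}{d(d-1)}$. Then: (i) There is exactly one vector in $\mathbb{R}^d$ of the form $$\boldsymbol{x}_4^{\max}=(a,\underbrace{b,\dots,b}_{\beta\text{ times}},c,\underbrace{0,\dots,0}_{d-\beta-2\text{ times}}),\qquad \beta\in\{0,1,\dots,d-2\},$$ with non-negative entries in non-increasing order, whose entries have power sums of orders $1,2,3$ equal to $p_1,p_2,p_3$ respectively. There is likewise exactly one vector in $\mathbb{R}^d$ of the form $$\boldsymbol{x}_4^{\min}=(\underbrace{a,\dots,a}_{\gamma\text{ times}},b,\underbrace{c,\dots,c}_{d-\gamma-1\text{ times}}),\qquad \gamma\in\{1,\dots,d-1\},$$ with non-negative entries in non-increasing order, whose entries have power sums of orders $1,2,3$ equal to $p_1,p_2,p_3$ respectively. (ii) Let $\hat p_4^{\max}$ and $\hat p_4^{\min}$ be the sums of the fourth powers of the entries of $\boldsymbol{x}_4^{\max}$ and $\boldsymbol{x}_4^{\min}$, respectively. For every real number $p_4$, there exists a separable state $\rho_{AB}$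 on $\mathcal{H}_A\otimes\mathcal{H}_B$ with $p_k=\operatorname{Tr}[(\rho_{AB}^{T_A})^k]$ for $k=1,2,3,4$ if and only if $$\hat p_4^{\min}\le p_4\le\hat p_4^{\max}.$$
   Context: A quantum state on $\mathcal{H}_A\otimes\mathcal{H}_B$ is a positive semidefinite operator of trace one. It is separable if it is a convex combination of product states $\sigma_A\otimes\sigma_B$ (with $\sigma_A$, $\sigma_B$ quantum states on $\mathcal{H}_A$, $\mathcal{H}_B$). $\rho_{AB}^{T_A}$ denotes the partial transpose on $\mathcal{H}_A$ with respect to a fixed orthonormal basis, i.e. the linear map determined by $(X\otimes Y)^{T_A}=X^T\otimes Y$. The power sum of order $k$ of the entries of $(x_1,\dots,x_d)$ is $\sum_{i=1}^d x_i^k$. In (i), uniqueness refers to the vector in $\mathbb{R}^d$; blocks of zero length are empty, and in the second form the block of $c$'s is empty when $\gamma=d-1$, while in the first form the block of $b$'s is empty when $\beta=0$. *)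

(* Defs.v *)
From mathcomp Require Import all_boot all_order all_algebra.
From mathcomp Require Import reals.
From mathcomp.real_closed Require Import complex mxtens.

Set Implicit Arguments.
Unset Strict Implicit.
Unset Printing Implicit Defensive.

Import Order.TTheory GRing.Theory Num.Theory.
Local Open Scope ring_scope.
Local Open Scope complex_scope.
Local Open Scope sesquilinear_scope.

(* Operators on a complex Hilbert space of finite dimension n are represented
   by their matrices over R[i] in a fixed orthonormal basis; with the product
   basis, an operator on the tensor product of spaces of dimensions m and n is
   an (m * n) x (m * n) matrix, and the tensor product of operators is the
   Kronecker product *t of mxtens. *)

Definition psdmx (R : realType) (n : nat) (M : 'M[R[i]]_n) : Prop :=
  M \is hermsymmx /\ forall v : 'rV[R[i]]_n, 0 <= (v *m M *m v ^t*) 0 0.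

Definition qstate (R : realType) (n : nat) (rho : 'M[R[i]]_n) : Prop :=
  psdmx rho /\ \tr rho = 1.

Definition separable_state (R : realType) (dA dB : nat)
    (rho : 'M[R[i]]_(dA * dB)) : Prop :=
  qstate rho /\
  exists (n : nat) (w : 'I_n -> R)
    (sA : 'I_n -> 'M[R[i]]_dA) (sB : 'I_n -> 'M[R[i]]_dB),
    [/\ forall k, 0 <= w k,
        \sum_(k < n) w k = 1,
        forall k, qstate (sA k),
        forall k, qstate (sB k)
      & rho = \sum_(k < n) (w k)%:C *: (sA k *t sB k)].

(* The entry of index ((i, j), (k, l)) is that of M of index ((k, j), (i, l));
   ptransposeA_is_linear and ptransposeA_tens give the usual
   characterization. *)
Definition ptransposeA (C : comNzRingType) (dA dB : nat)
    (M : 'M[C]_(dA * dB)) : 'M[C]_(dA * dB) :=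
  \matrix_(r, s)
    M (mxtens_index ((mxtens_unindex s).1, (mxtens_unindex r).2))
      (mxtens_index ((mxtens_unindex r).1, (mxtens_unindex s).2)).

Fact ptransposeA_is_linear (C : comNzRingType) (dA dB : nat) :
  linear (@ptransposeA C dA dB).
Proof. by move=> a M N; apply/matrixP=> r s; rewrite !mxE. Qed.

Fact ptransposeA_tens (C : comNzRingType) (dA dB : nat)
    (X : 'M[C]_dA) (Y : 'M[C]_dB) :
  ptransposeA (X *t Y) = X^T *t Y.
Proof. by apply/matrixP=> r s; rewrite !mxE !mxtens_indexK. Qed.

Definition psum (R : realType) (d : nat) (k : nat) (v : 'rV[R]_d) : R :=
  \sum_(i < d) v 0 i ^+ k.

Definition nneg_noninc (R : realType) (d : nat) (v : 'rV[R]_d) : Prop :=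
  (forall i, 0 <= v 0 i) /\
  (forall i j : 'I_d, (i <= j)%N -> v 0 j <= v 0 i).

Definition has_psums (R : realType) (d : nat) (p1 p2 p3 : R)
    (v : 'rV[R]_d) : Prop :=
  [/\ psum 1 v = p1, psum 2 v = p2 & psum 3 v = p3].

(* (a, b, ..., b, c, 0, ..., 0), with b at the positions 1, ..., beta. *)
Definition max_form (R : realType) (d : nat) (v : 'rV[R]_d) : Prop :=
  exists (beta : nat) (a b c : R),
    (beta.+2 <= d)%N /\
    v = \row_(i < d) (if i == 0%N :> nat then a
                      else if (i <= beta)%N then b
                      else if i == beta.+1 :> nat then c
                      else 0).

(* (a, ..., a, b, c, ..., c), with b at the position gamma. *)
Definition min_form (R : realType) (d : nat) (v : 'rV[R]_d) : Prop :=
  exists (gamma : nat) (a b c : R),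
    (1 <= gamma <= d.-1)%N /\
    v = \row_(i < d) (if (i < gamma)%N then a
                      else if i == gamma :> nat then b
                      else c).

Definition is_x4max (R : realType) (d : nat) (p1 p2 p3 : R)
    (v : 'rV[R]_d) : Prop :=
  [/\ max_form v, nneg_noninc v & has_psums p1 p2 p3 v].

Definition is_x4min (R : realType) (d : nat) (p1 p2 p3 : R)
    (v : 'rV[R]_d) : Prop :=
  [/\ min_form v, nneg_noninc v & has_psums p1 p2 p3 v].

Definition p3_lower (R : realType) (p2 : R) : R :=
  let alpha : R := (Num.floor (1 / p2))%:~R in
  let x := (alpha + Num.sqrt (alpha * (p2 * (alpha + 1) - 1)))
             / (alpha * (alpha + 1)) in
  alpha * x ^+ 3 + (1 - alpha * x) ^+ 3.

Definition p3_upper (R : realType) (d : nat) (p2 : R) : R :=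
  let y := (d%:R - 1 - Num.sqrt ((d%:R - 1) * (p2 * d%:R - 1)))
             / (d%:R * (d%:R - 1)) in
  (1 - (d%:R - 1) * y) ^+ 3 + (d%:R - 1) * y ^+ 3.

(* Main.v *)
Require Import Defs.
From mathcomp Require Import all_boot all_order all_algebra.
From mathcomp Require Import reals.
From mathcomp.real_closed Require Import complex mxtens.
From mathcomp Require Import zify lra ring.
From mathcomp Require Import boolp classical_sets topology normedtype derive realfun.

Set Implicit Arguments.
Unset Strict Implicit.
Unset Printing Implicit Defensive.

Import Order.TTheory GRing.Theory Num.Theory.
Import numFieldNormedType.Exports.
Local Open Scope ring_scope.
Local Open Scope complex_scope.

(* The partial transpose of a separable state is positive semidefinite, and a
   diagonal state is separable and equal to its partial transpose; so the
   question is which p4 occur as fourth power sums of probability vectors with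
   given second and third power sums.
   Shifting the polynomial prod (t - x_i) of four entries by a constant keeps
   their power sums of orders 1, 2, 3 and moves that of order 4.  Four entries
   x1 >= x2 > x3 >= x4 > 0 allow an arbitrarily small increase, and
   x1 > x2 >= x3 > x4 >= 0 a decrease, so a maximizer must have the form
   x_4^max and a minimizer the form x_4^min.  Two vectors of the same form
   differ by at most two sign changes, which is incompatible with three equal
   power sums; hence uniqueness.  If a level between the two extremes were not
   attained, a maximizer below that level could still be slightly improved.  The
   same argument one degree lower, with cubics, shows that p3 is attained. *)

(** * Spectra of partial transposes of separable states *)

Section PartialTransposeSpectrum.
Local Open Scope sesquilinear_scope.
Variable R : realType.
Local Notation C := R[i].

Lemma conjC_real (r : R) : Num.conj r%:C = r%:C :> C.
Proof. exact: conjc_real. Qed.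

Lemma mul_adj_diag n (u : 'rV[C]_n) :
  (u *m u ^t*) 0 0 = \sum_i `|u 0 i| ^+ 2.
Proof. by rewrite mxE; apply: eq_bigr => i _; rewrite !mxE -normCK. Qed.

Lemma adj_mul m n p (A : 'M[C]_(m, n)) (B : 'M[C]_(n, p)) :
  (A *m B) ^t* = B ^t* *m A ^t*.
Proof. by rewrite trmx_mul map_mxM. Qed.

Lemma psdmx_mul_adj m n (B : 'M[C]_(m, n)) : psdmx (B *m B ^t*).
Proof.
split.
  by apply/is_hermitianmxP; rewrite expr0 scale1r adj_mul trmxCK.
move=> v; rewrite mulmxA -mulmxA -adj_mul mul_adj_diag.
by apply: sumr_ge0 => i _; rewrite exprn_ge0.
Qed.

Lemma psdmx_sum n (I : finType) (w : I -> R) (M : I -> 'M[C]_n) :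
  (forall k, 0 <= w k) -> (forall k, psdmx (M k)) ->
  psdmx (\sum_k (w k)%:C *: M k).
Proof.
move=> w0 psdM; split.
  apply/is_hermitianmxP; rewrite expr0 scale1r [RHS]/map_mx.
  apply/matrixP => r s; rewrite !mxE !summxE rmorph_sum /=.
  apply: eq_bigr => k _; rewrite !mxE.
  have [/is_hermitianmxP + _] := psdM k; rewrite expr0 scale1r => {1}->.
  by rewrite !mxE [RHS]rmorphM /= conjC_real.
move=> v; rewrite mulmx_sumr mulmx_suml summxE.
apply: sumr_ge0 => k _; rewrite -scalemxAr -scalemxAl mxE mulr_ge0 ?ler0c //.
by case: (psdM k).
Qed.

(** A hermitian matrix is normal, hence unitarily diagonalizable. Its [i]-th eigenvalue is the
    quadratic form at row [i] of [U], so it is non-negative in [C], which also forces its imaginary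
    part to vanish. *)
Lemma psdmx_spectral n (M : 'M[C]_n) : psdmx M ->
  exists (U : 'M[C]_n) (x : 'rV[R]_n),
    [/\ U \is unitarymx, forall i, 0 <= x 0 i &
        M = invmx U *m diag_mx (map_mx (real_complex R) x) *m U].
Proof.
move=> [hM pM].
have /orthomx_spectralP := hermitian_normalmx hM.
set U := spectralmx M; set s := spectral_diag M => defM.
have unU : U \is unitarymx by exact: spectral_unitarymx.
have s_ge0 i : 0 <= s 0 i.
  have := pM (row i U); rewrite defM !mulmxA.
  have -> : row i U *m invmx U = delta_mx 0 i.
    by rewrite rowE mulmxK // unitarymx_unit.
  rewrite -!mulmxA.
  have -> : U *m (row i U)^t* = (delta_mx 0 i)^t*.
    by rewrite rowE adj_mul mulmxA (unitarymxP unU) mul1mx.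
  rewrite mul_diag_mx mxE (bigD1 i) //= big1 ?addr0 => [|j jNi].
    by rewrite !mxE !eqxx conjC1 mulr1 mul1r.
  by rewrite !mxE eqxx (negPf jNi) mul0r.
have sE : map_mx (real_complex R) (map_mx (@complex.Re R) s) = s.
  apply/rowP => i; rewrite !mxE; have := s_ge0 i.
  by case: (s 0 i) => a b; rewrite lecE /= => /andP[/eqP-> _].
exists U, (map_mx (@complex.Re R) s).
split; [exact: unU | move=> i | by rewrite sE -defM].
by rewrite mxE; have := s_ge0 i; rewrite lecE => /andP[].
Qed.

(** Take square roots of the eigenvalues. Such a factorization reduces stability under transposition
    and tensor products to [psdmx_mul_adj]. *)
Lemma psdmx_factor n (M : 'M[C]_n) : psdmx M -> exists B : 'M[C]_n, M = B *m B ^t*.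
Proof.
move=> /psdmx_spectral[U [x [unU x0 ->]]].
exists (invmx U *m diag_mx (map_mx (fun t => (Num.sqrt t)%:C) x)).
rewrite adj_mul !mulmxA; congr (_ *m _); last by rewrite invmx_unitary // trmxCK.
rewrite -mulmxA; congr (_ *m _); apply/matrixP => i j.
rewrite mul_diag_mx !mxE eq_sym; case: eqP => [->|_].
  by rewrite !mulr1n conjC_real -rmorphM /= -expr2 sqr_sqrtr.
by rewrite !mulr0n conjC0 mulr0.
Qed.

(** If [M] factors through [B], its transpose factors in the same way through the entrywise
    conjugate of [B]. *)
Lemma psdmx_tr n (M : 'M[C]_n) : psdmx M -> psdmx M^T.
Proof.
move=> /psdmx_factor[B ->]; rewrite trmx_mul.
have -> : (B ^t*)^T = map_mx Num.conj B by apply/matrixP => i j; rewrite !mxE.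
have -> : B^T = (map_mx Num.conj B) ^t*.
  by apply/matrixP => i j; rewrite !mxE conjCK.
exact: psdmx_mul_adj.
Qed.

Lemma psdmx_tens m n (M : 'M[C]_m) (N : 'M[C]_n) :
  psdmx M -> psdmx N -> psdmx (M *t N).
Proof.
move=> /psdmx_factor[A ->] /psdmx_factor[B ->].
rewrite -tensmx_mul -map_mxT -trmx_tens.
exact: psdmx_mul_adj.
Qed.

Lemma mxtrace_tens m n (M : 'M[C]_m) (N : 'M[C]_n) :
  \tr (M *t N) = \tr M * \tr N.
Proof.
by rewrite /mxtrace mulr_sum; apply: eq_bigr => k _; rewrite mxE.
Qed.

Lemma diag_mx_exp n (x : 'rV[C]_n) k :
  diag_mx x ^+ k = diag_mx (map_mx (fun t => t ^+ k) x).
Proof.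
elim: k => [|k IHk].
  by rewrite expr0; apply/matrixP => i j; rewrite !mxE.
rewrite exprS IHk -[_ * _]/(_ *m _) mulmx_diag; congr diag_mx.
by apply/rowP => i; rewrite !mxE exprS.
Qed.

Lemma mxtrace_diag_exp n (x : 'rV[R]_n) k :
  \tr (diag_mx (map_mx (real_complex R) x) ^+ k) = (psum k x)%:C.
Proof.
rewrite diag_mx_exp mxtrace_diag /psum rmorph_sum /=.
by apply: eq_bigr => i _; rewrite !mxE rmorphXn.
Qed.

Lemma psdmx_power_sums n (M : 'M[C]_n) : psdmx M ->
  exists x : 'rV[R]_n, (forall i, 0 <= x 0 i) /\
    forall k, \tr (M ^+ k) = (psum k x)%:C.
Proof.
move=> /psdmx_spectral[U [x [unU x0 defM]]]; exists x; split=> // k.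
have unitU := unitarymx_unit unU.
have -> : M ^+ k =
    invmx U *m (diag_mx (map_mx (real_complex R) x) ^+ k) *m U.
  elim: k => [|k IHk]; first by rewrite !expr0 mulmx1 mulVmx.
  rewrite !exprS IHk {1}defM -![_ * _]/(_ *m _) !mulmxA.
  by rewrite mulmxK.
by rewrite mxtrace_mulC mulmxA mulmxV // mul1mx mxtrace_diag_exp.
Qed.

Lemma ptransposeA_sum (dA dB : nat) (I : finType) (w : I -> C)
    (M : I -> 'M[C]_(dA * dB)) :
  ptransposeA (\sum_k w k *: M k) = \sum_k w k *: ptransposeA (M k).
Proof.
apply/matrixP => r s; rewrite !mxE !summxE; apply: eq_bigr => k _.
by rewrite !mxE.
Qed.

(** On a product term the partial transpose only transposes the first factor, which stays positive
    semidefinite; the weights are non-negative. *)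
Lemma psdmx_ptransposeA_separable (dA dB : nat) (rho : 'M[C]_(dA * dB)) :
  separable_state rho -> psdmx (ptransposeA rho).
Proof.
move=> [_ [n [w [sA [sB [w0 _ hA hB ->]]]]]]; rewrite ptransposeA_sum.
apply: psdmx_sum => // k; rewrite ptransposeA_tens.
by apply: psdmx_tens; [apply: psdmx_tr; case: (hA k)|case: (hB k)].
Qed.

Lemma qstate_delta n (i : 'I_n) : qstate (delta_mx i i : 'M[C]_n).
Proof.
split; last first.
  rewrite /mxtrace (bigD1 i) //= big1 ?addr0 ?mxE ?eqxx // => j jNi.
  by rewrite mxE (negPf jNi).
have -> : delta_mx i i = delta_mx i 0 *m (delta_mx i 0 : 'cV[C]_n) ^t*.
  rewrite trmx_delta map_delta_mx; exact/esym/mul_delta_mx.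
exact: psdmx_mul_adj.
Qed.

(** Each diagonal matrix unit is a product of two pure basis states, so the entries of [x] serve as
    the convex weights. *)
Lemma diag_mx_separable (dA dB : nat) (x : 'rV[R]_(dA * dB)) :
  (forall i, 0 <= x 0 i) -> psum 1 x = 1 ->
  separable_state (diag_mx (map_mx (real_complex R) x)).
Proof.
move=> x0 sum1.
pose sA (k : 'I_(dA * dB)) : 'M[C]_dA :=
  delta_mx (mxtens_unindex k).1 (mxtens_unindex k).1.
pose sB (k : 'I_(dA * dB)) : 'M[C]_dB :=
  delta_mx (mxtens_unindex k).2 (mxtens_unindex k).2.
have sAB k : sA k *t sB k = delta_mx k k.
  case: (mxtens_indexP k) => i j; rewrite /sA /sB !mxtens_indexK /=.
  apply/matrixP => r s; case: (mxtens_indexP r) (mxtens_indexP s) => a b [c e].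
  rewrite !mxE !mxtens_indexK /= -natrM mulnb !(can_eq (@mxtens_indexK _ _)).
  by rewrite -!pair_eqE /= andbACA.
have def : diag_mx (map_mx (real_complex R) x) =
    \sum_k (x 0 k)%:C *: (sA k *t sB k).
  rewrite diag_mx_sum_delta; apply: eq_bigr => k _.
  by rewrite sAB mxE.
split; last first.
  exists (dA * dB)%N, (fun k => x 0 k), sA, sB; split=> //.
  - by move=> k; exact: qstate_delta.
  - by move=> k; exact: qstate_delta.
split; last by have := mxtrace_diag_exp x 1; rewrite expr1 sum1.
rewrite def; apply: psdmx_sum => // k.
by apply: psdmx_tens; apply: (qstate_delta _).1.
Qed.

Lemma ptransposeA_diag (dA dB : nat) (x : 'rV[C]_(dA * dB)) :
  ptransposeA (diag_mx x) = diag_mx x.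
Proof.
apply/matrixP => r s; case: (mxtens_indexP r) (mxtens_indexP s) => a b [c e].
rewrite !mxE !mxtens_indexK /= !(can_eq (@mxtens_indexK _ _)) -!pair_eqE /=.
rewrite (eq_sym c a); case: (a =P c) => [->|//].
by case: (b =P e) => [->|].
Qed.

(** [I] selects the prescribed orders. From left to right, [x] lists the eigenvalues of the partial
    transpose; from right to left, the diagonal state with entries [x] works, order 1 giving it
    trace one. *)
Lemma separable_moments (dA dB : nat) (p : nat -> R) (I : pred nat) :
  I 1%N -> p 1%N = 1 ->
  (exists rho : 'M[C]_(dA * dB), separable_state rho /\
     forall k, I k -> (p k)%:C = \tr (ptransposeA rho ^+ k)) <->
  (exists x : 'rV[R]_(dA * dB), (forall i, 0 <= x 0 i) /\
     forall k, I k -> psum k x = p k).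
Proof.
move=> I1 p1; split=> [[rho [sep tr]]|[x [x0 px]]].
  have [x [x0 px]] := psdmx_power_sums (psdmx_ptransposeA_separable sep).
  by exists x; split=> // k /tr; rewrite px => -[].
exists (diag_mx (map_mx (real_complex R) x)); split=> [|k Ik].
  by apply: diag_mx_separable; rewrite ?px.
by rewrite ptransposeA_diag mxtrace_diag_exp px.
Qed.
End PartialTransposeSpectrum.

(** * Shifting cubics and quartics by a constant *)

Section RootShift.
Variable R : realType.

Lemma poly_root_between (p : {poly R}) (a b : R) : a < b ->
  p.[a] * p.[b] < 0 -> exists2 y, a < y < b & root p y.
Proof.
move=> ab sgn.
wlog : p sgn / p.[a] < 0 => [hw|pa].
  have [pa|pa|pa] := ltgtP p.[a] 0; first exact: hw.
  - have [||y yab] := hw (- p); rewrite ?hornerN ?mulrNN ?oppr_lt0 //.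
    by rewrite rootN; exists y.
  - by rewrite pa mul0r ltxx in sgn.
have pb : 0 < p.[b] by rewrite nmulr_rlt0 // in sgn.
have [|y /andP[ay yb] ry] := @poly_ivt _ p a b (ltW ab).
  by rewrite !ltW.
exists y => //; rewrite !lt_neqAle ay yb !andbT; apply/andP; split.
- by apply: contraTneq ry => <-; rewrite rootE lt_eqF.
- by apply: contraTneq ry => ->; rewrite rootE gt_eqF.
Qed.

(** A monic polynomial is determined by as many distinct roots as its degree, and subtracting a
    constant keeps it monic of the same degree. *)
Lemma prod_shift (xs ys : seq R) (e : R) :
  (0 < size xs)%N -> size ys = size xs -> uniq ys ->
  {in ys, forall y, \prod_(x <- xs) (y - x) = e} ->
  forall t, \prod_(x <- xs) (t - x) - e = \prod_(y <- ys) (t - y).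
Proof.
move=> xs0 szys uys rooty t.
pose q (s : seq R) := \prod_(z <- s) ('X - z%:P).
have szq : size (q xs) = (size xs).+1 by rewrite size_prod_XsubC.
have sze : (size (- e%:P) < size (q xs))%N.
  by rewrite szq size_polyN; apply: leq_ltn_trans (size_polyC_leq1 _) _.
have qE s u : (q s).[u] = \prod_(z <- s) (u - z).
  rewrite /q horner_prod; apply: eq_bigr => z _.
  by rewrite hornerD hornerX hornerN hornerC.
have defp : q xs - e%:P = q ys.
  rewrite [LHS](@all_roots_prod_XsubC _ _ ys) ?uniq_rootsE //.
  - by rewrite lead_coefDl // (monicP _) ?scale1r // monic_prod_XsubC.
  - by rewrite size_polyDl // szq szys.
  - apply/allP => y /rooty ye.
    by rewrite rootE hornerD hornerN hornerC qE ye subrr.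
by rewrite -!qE -defp hornerD hornerN hornerC.
Qed.

(** The shift changes only the constant coefficient, that is, the third elementary symmetric
    function; Newton's identities translate this into power sums. *)
Lemma cubic_shift (x1 x2 x3 y1 y2 y3 e : R) :
  y3 < y2 < y1 ->
  (forall y, y \in [:: y1; y2; y3] ->
     (y - x1) * (y - x2) * (y - x3) = e) ->
  [/\ y1 + y2 + y3 = x1 + x2 + x3,
      y1 ^+ 2 + y2 ^+ 2 + y3 ^+ 2 = x1 ^+ 2 + x2 ^+ 2 + x3 ^+ 2 &
      y1 ^+ 3 + y2 ^+ 3 + y3 ^+ 3 = x1 ^+ 3 + x2 ^+ 3 + x3 ^+ 3 + 3 * e].
Proof.
move=> /andP[y32 y21] rooty.
have eqp t : (t - x1) * (t - x2) * (t - x3) - e =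
    (t - y1) * (t - y2) * (t - y3).
  have := @prod_shift [:: x1; x2; x3] [:: y1; y2; y3] e isT erefl _ _ t.
  rewrite !big_cons !big_nil !mulr1 !mulrA; apply.
  - by rewrite /= !inE !negb_or !gt_eqF // (lt_trans y32).
  - by move=> y /rooty; rewrite !big_cons big_nil mulr1 !mulrA.
(* Three evaluations give a linear system that determines the three elementary symmetric
   functions. *)
have := eqp 0; have := eqp 1; have := eqp (-1) => fN1 f1 f0.
pose e1 (a b c : R) := a + b + c.
pose e2 (a b c : R) := a * b + a * c + b * c.
pose e3 (a b c : R) := a * b * c.
have E1 : e1 y1 y2 y3 = e1 x1 x2 x3 by rewrite /e1; lra.
have E2 : e2 y1 y2 y3 = e2 x1 x2 x3 by rewrite /e2; lra.
have E3 : e3 y1 y2 y3 = e3 x1 x2 x3 + e by rewrite /e3; lra.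
have N2 a b c : a ^+ 2 + b ^+ 2 + c ^+ 2 =
    e1 a b c ^+ 2 - 2 * e2 a b c by rewrite /e1 /e2; ring.
have N3 a b c : a ^+ 3 + b ^+ 3 + c ^+ 3 =
    e1 a b c ^+ 3 - 3 * e1 a b c * e2 a b c + 3 * e3 a b c.
  by rewrite /e1 /e2 /e3; ring.
split; first exact: E1.
- by rewrite !N2 E1 E2.
- by rewrite !N3 E1 E2 E3; ring.
Qed.

(** As for cubics: only the fourth elementary symmetric function moves, by [- e], and it enters the
    fourth power sum with coefficient -4. *)
Lemma quartic_shift (x1 x2 x3 x4 y1 y2 y3 y4 e : R) :
  y4 < y3 < y2 -> y2 < y1 ->
  (forall y, y \in [:: y1; y2; y3; y4] ->
     (y - x1) * (y - x2) * (y - x3) * (y - x4) = e) ->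
  [/\ y1 + y2 + y3 + y4 = x1 + x2 + x3 + x4,
      y1 ^+ 2 + y2 ^+ 2 + y3 ^+ 2 + y4 ^+ 2
        = x1 ^+ 2 + x2 ^+ 2 + x3 ^+ 2 + x4 ^+ 2,
      y1 ^+ 3 + y2 ^+ 3 + y3 ^+ 3 + y4 ^+ 3
        = x1 ^+ 3 + x2 ^+ 3 + x3 ^+ 3 + x4 ^+ 3 &
      y1 ^+ 4 + y2 ^+ 4 + y3 ^+ 4 + y4 ^+ 4
        = x1 ^+ 4 + x2 ^+ 4 + x3 ^+ 4 + x4 ^+ 4 + 4 * e].
Proof.
move=> /andP[y43 y32] y21 rooty.
have eqp t : (t - x1) * (t - x2) * (t - x3) * (t - x4) - e =
    (t - y1) * (t - y2) * (t - y3) * (t - y4).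
  have := @prod_shift [:: x1; x2; x3; x4] [:: y1; y2; y3; y4] e isT erefl _ _ t.
  rewrite !big_cons !big_nil !mulr1 !mulrA; apply.
  - have y42 := lt_trans y43 y32; have y31 := lt_trans y32 y21.
    by rewrite /= !inE !negb_or !gt_eqF // (lt_trans y42).
  - by move=> y /rooty; rewrite !big_cons big_nil mulr1 !mulrA.
have := eqp 0; have := eqp 1; have := eqp (-1); have := eqp 2 => f2 fN1 f1 f0.
pose e1 (a b c d : R) := a + b + c + d.
pose e2 (a b c d : R) := a * b + a * c + a * d + b * c + b * d + c * d.
pose e3 (a b c d : R) := a * b * c + a * b * d + a * c * d + b * c * d.
pose e4 (a b c d : R) := a * b * c * d.
have E4 : e4 y1 y2 y3 y4 = e4 x1 x2 x3 x4 - e by rewrite /e4; lra.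
have E1 : e1 y1 y2 y3 y4 = e1 x1 x2 x3 x4 by rewrite /e1; lra.
have E2 : e2 y1 y2 y3 y4 = e2 x1 x2 x3 x4 by rewrite /e2; lra.
have E3 : e3 y1 y2 y3 y4 = e3 x1 x2 x3 x4 by rewrite /e3; lra.
have N2 a b c d : a ^+ 2 + b ^+ 2 + c ^+ 2 + d ^+ 2 =
    e1 a b c d ^+ 2 - 2 * e2 a b c d by rewrite /e1 /e2; ring.
have N3 a b c d : a ^+ 3 + b ^+ 3 + c ^+ 3 + d ^+ 3 =
    e1 a b c d ^+ 3 - 3 * e1 a b c d * e2 a b c d + 3 * e3 a b c d.
  by rewrite /e1 /e2 /e3; ring.
have N4 a b c d : a ^+ 4 + b ^+ 4 + c ^+ 4 + d ^+ 4 =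
    e1 a b c d ^+ 4 - 4 * e1 a b c d ^+ 2 * e2 a b c d
    + 2 * e2 a b c d ^+ 2 + 4 * e1 a b c d * e3 a b c d - 4 * e4 a b c d.
  by rewrite /e1 /e2 /e3 /e4; ring.
split; first exact: E1.
- by rewrite !N2 E1 E2.
- by rewrite !N3 E1 E2 E3.
- by rewrite !N4 E1 E2 E3 E4; ring.
Qed.

Lemma prod_crossing (xs : seq R) (e a b : R) : a < b ->
  (\prod_(x <- xs) (a - x) - e) * (\prod_(x <- xs) (b - x) - e) < 0 ->
  exists2 y, a < y < b & \prod_(x <- xs) (y - x) = e.
Proof.
move=> ab.
have pE t : (\prod_(x <- xs) ('X - x%:P) - e%:P).[t] =
    \prod_(x <- xs) (t - x) - e.
  rewrite hornerD hornerN hornerC horner_prod; congr (_ - _).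
  by apply: eq_bigr => x _; rewrite hornerD hornerX hornerN hornerC.
rewrite -!pE => /(poly_root_between ab)[y yab].
by rewrite rootE pE subr_eq0 => /eqP; exists y.
Qed.

Lemma cubic_crossing (x1 x2 x3 e a b : R) : a < b ->
  ((a - x1) * (a - x2) * (a - x3) - e) *
    ((b - x1) * (b - x2) * (b - x3) - e) < 0 ->
  exists2 y, a < y < b & (y - x1) * (y - x2) * (y - x3) = e.
Proof.
move=> ab; have := @prod_crossing [:: x1; x2; x3] e a b ab.
rewrite !big_cons !big_nil !mulr1 !mulrA => h /h[y yab].
by rewrite !big_cons big_nil mulr1 mulrA; exists y.
Qed.

Lemma quartic_crossing (x1 x2 x3 x4 e a b : R) : a < b ->
  ((a - x1) * (a - x2) * (a - x3) * (a - x4) - e) *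
    ((b - x1) * (b - x2) * (b - x3) * (b - x4) - e) < 0 ->
  exists2 y, a < y < b & (y - x1) * (y - x2) * (y - x3) * (y - x4) = e.
Proof.
move=> ab; have := @prod_crossing [:: x1; x2; x3; x4] e a b ab.
rewrite !big_cons !big_nil !mulr1 !mulrA => h /h[y yab].
by rewrite !big_cons big_nil mulr1 !mulrA; exists y.
Qed.

Lemma ex_pos_below (s : seq R) : all (fun z => 0 < z) s ->
  exists2 e, 0 < e & all (fun z => e < z) s.
Proof.
elim: s => [|z s IHs] /=; first by exists 1.
case/andP => z0 /IHs[e e0 es]; exists (Num.min (z / 2) e).
  by rewrite lt_min e0 divr_gt0.
rewrite gt_min ltr_pdivrMr ?ltr_pMr ?ltr1n //=.
by apply: sub_all es => t et; rewrite gt_min et orbT.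
Qed.

(** The cubic with roots [x1], [x2], [x3] takes a small value [e > 0] once above [x1] and twice
    between [x3] and [x2]. All crossings lie above [x3], hence stay non-negative. *)
Lemma cubic_increase (x1 x2 x3 e0 : R) :
  0 < e0 -> x2 <= x1 -> x3 < x2 -> 0 <= x3 ->
  exists y1 y2 y3 e : R,
    [/\ [&& 0 <= y1, 0 <= y2 & 0 <= y3], 0 < e <= e0,
        y1 + y2 + y3 = x1 + x2 + x3,
        y1 ^+ 2 + y2 ^+ 2 + y3 ^+ 2 = x1 ^+ 2 + x2 ^+ 2 + x3 ^+ 2 &
        y1 ^+ 3 + y2 ^+ 3 + y3 ^+ 3 = x1 ^+ 3 + x2 ^+ 3 + x3 ^+ 3 + e].
Proof.
move=> e00 x21 x32 x30; pose m := (x2 + x3) / 2.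
have [m2 m3] : m < x2 /\ x3 < m by rewrite /m; split; lra.
have Fm : 0 < (x1 - m) * (x2 - m) * (m - x3).
  by rewrite !mulr_gt0 ?subr_gt0 // (lt_le_trans m2).
(* The bound 1 puts the top crossing below [x1 + 1], the value at [m] yields a crossing on each side
   of [m], and [e0 / 3] limits the gain [3 * e]. *)
have [|e e_gt0 /and4P[e1 em ee _]] :=
    @ex_pos_below [:: 1; (x1 - m) * (x2 - m) * (m - x3); e0 / 3].
  by rewrite /= Fm divr_gt0 // ltr01.
have Ftop : 1 <= (x1 + 1 - x1) * (x1 + 1 - x2) * (x1 + 1 - x3).
  by rewrite !mulr_ege1 //; lra.
have [||y1 /andP[y1l _] F1] := @cubic_crossing x1 x2 x3 e x1 (x1 + 1).
- by lra.
- by rewrite subrr !mul0r sub0r nmulr_rlt0; lra.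
have [||y2 /andP[y2l y2r] F2] := @cubic_crossing x1 x2 x3 e m x2 => //.
- by rewrite subrr mulr0 mul0r sub0r nmulr_llt0; lra.
have [||y3 /andP[y3l y3r] F3] := @cubic_crossing x1 x2 x3 e x3 m => //.
- by rewrite subrr mulr0 sub0r nmulr_rlt0; lra.
have [||E1 E2 E3] := @cubic_shift x1 x2 x3 y1 y2 y3 e.
- by apply/andP; split; lra.
- by move=> y; rewrite !inE => /or3P[]/eqP->.
exists y1, y2, y3, (3 * e); split=> //; first by apply/and3P; split; lra.
by apply/andP; split; lra.
Qed.

(** At a small level [e > 0] the quartic has a crossing above [x1], two between [x3] and [x2], and
    one below [x4]. The last one stays positive as soon as [e] is less than the value
    [x1 * x2 * x3 * x4] at 0, whence the condition [0 < x4]. *)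
Lemma quartic_increase (x1 x2 x3 x4 e0 : R) :
  0 < e0 -> x2 <= x1 -> x3 < x2 -> x4 <= x3 -> 0 < x4 ->
  exists y1 y2 y3 y4 e : R,
    [/\ [&& 0 <= y1, 0 <= y2, 0 <= y3 & 0 <= y4] /\ 0 < e <= e0,
        y1 + y2 + y3 + y4 = x1 + x2 + x3 + x4,
        y1 ^+ 2 + y2 ^+ 2 + y3 ^+ 2 + y4 ^+ 2
          = x1 ^+ 2 + x2 ^+ 2 + x3 ^+ 2 + x4 ^+ 2,
        y1 ^+ 3 + y2 ^+ 3 + y3 ^+ 3 + y4 ^+ 3
          = x1 ^+ 3 + x2 ^+ 3 + x3 ^+ 3 + x4 ^+ 3 &
        y1 ^+ 4 + y2 ^+ 4 + y3 ^+ 4 + y4 ^+ 4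
          = x1 ^+ 4 + x2 ^+ 4 + x3 ^+ 4 + x4 ^+ 4 + e].
Proof.
move=> e00 x21 x32 x43 x40; pose m := (x2 + x3) / 2.
have [m2 m3] : m < x2 /\ x3 < m by rewrite /m; split; lra.
have Fm : 0 < (x1 - m) * (x2 - m) * (m - x3) * (m - x4).
  by rewrite !mulr_gt0 ?subr_gt0 // ?(lt_le_trans m2) // (le_lt_trans x43).
have F0 : 0 < x1 * x2 * x3 * x4 by rewrite !mulr_gt0; lra.
have [|e e_gt0 /and5P[e1 em ez ee _]] :=
    @ex_pos_below [:: 1; (x1 - m) * (x2 - m) * (m - x3) * (m - x4);
                      x1 * x2 * x3 * x4; e0 / 4].
  by rewrite /= Fm F0 divr_gt0 // ltr01.
have Ftop : 1 <= (x1 + 1 - x1) * (x1 + 1 - x2) * (x1 + 1 - x3) * (x1 + 1 - x4).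
  by rewrite !mulr_ege1 //; lra.
have [||y1 /andP[y1l _] F1] := @quartic_crossing x1 x2 x3 x4 e x1 (x1 + 1).
- by lra.
- by rewrite subrr !mul0r sub0r nmulr_rlt0; lra.
have [||y2 /andP[y2l y2r] F2] := @quartic_crossing x1 x2 x3 x4 e m x2 => //.
- by rewrite subrr mulr0 !mul0r sub0r nmulr_llt0; lra.
have [||y3 /andP[y3l y3r] F3] := @quartic_crossing x1 x2 x3 x4 e x3 m => //.
- by rewrite subrr mulr0 mul0r sub0r nmulr_rlt0; lra.
have [||y4 /andP[y4l y4r] F4] := @quartic_crossing x1 x2 x3 x4 e 0 x4 => //.
- by rewrite subrr mulr0 [0 - e]sub0r nmulr_llt0; lra.
have [|||E1 E2 E3 E4] := @quartic_shift x1 x2 x3 x4 y1 y2 y3 y4 e.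
- by apply/andP; split; lra.
- by lra.
- by move=> y; rewrite !inE => /or4P[]/eqP->.
exists y1, y2, y3, y4, (4 * e); split=> //; split.
  by apply/and4P; split; lra.
by apply/andP; split; lra.
Qed.

(** At a small negative level the crossings come in pairs, between [x2] and [x1] and between [x4]
    and [x3]. None falls below [x4], so [x4 = 0] is allowed. *)
Lemma quartic_decrease (x1 x2 x3 x4 : R) :
  x2 < x1 -> x3 <= x2 -> x4 < x3 -> 0 <= x4 ->
  exists y1 y2 y3 y4 e : R,
    [/\ [&& 0 <= y1, 0 <= y2, 0 <= y3 & 0 <= y4] /\ e < 0,
        y1 + y2 + y3 + y4 = x1 + x2 + x3 + x4,
        y1 ^+ 2 + y2 ^+ 2 + y3 ^+ 2 + y4 ^+ 2
          = x1 ^+ 2 + x2 ^+ 2 + x3 ^+ 2 + x4 ^+ 2,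
        y1 ^+ 3 + y2 ^+ 3 + y3 ^+ 3 + y4 ^+ 3
          = x1 ^+ 3 + x2 ^+ 3 + x3 ^+ 3 + x4 ^+ 3 &
        y1 ^+ 4 + y2 ^+ 4 + y3 ^+ 4 + y4 ^+ 4
          = x1 ^+ 4 + x2 ^+ 4 + x3 ^+ 4 + x4 ^+ 4 + e].
Proof.
move=> x21 x32 x43 x40; pose m := (x1 + x2) / 2; pose n := (x3 + x4) / 2.
have [m1 m2 n3 n4] : [/\ m < x1, x2 < m, n < x3 & x4 < n].
  by rewrite /m /n; split; lra.
have Fm : 0 < (x1 - m) * (m - x2) * (m - x3) * (m - x4).
  by rewrite !mulr_gt0; lra.
have Fn : 0 < (x1 - n) * (x2 - n) * (x3 - n) * (n - x4).
  by rewrite !mulr_gt0; lra.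
have [|e e_gt0 /and3P[em en _]] :=
    @ex_pos_below [:: (x1 - m) * (m - x2) * (m - x3) * (m - x4);
                      (x1 - n) * (x2 - n) * (x3 - n) * (n - x4)].
  by rewrite /= Fm Fn.
have [||y1 /andP[y1l y1r] F1] := @quartic_crossing x1 x2 x3 x4 (- e) m x1 => //.
- by rewrite subrr !mul0r sub0r opprK pmulr_llt0; lra.
have [||y2 /andP[y2l y2r] F2] := @quartic_crossing x1 x2 x3 x4 (- e) x2 m => //.
- by rewrite subrr mulr0 !mul0r sub0r opprK pmulr_rlt0; lra.
have [||y3 /andP[y3l y3r] F3] := @quartic_crossing x1 x2 x3 x4 (- e) n x3 => //.
- by rewrite subrr mulr0 mul0r sub0r opprK pmulr_llt0; lra.
have [||y4 /andP[y4l y4r] F4] := @quartic_crossing x1 x2 x3 x4 (- e) x4 n => //.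
- by rewrite subrr mulr0 [0 - - e]sub0r opprK pmulr_rlt0; lra.
have [|||E1 E2 E3 E4] := @quartic_shift x1 x2 x3 x4 y1 y2 y3 y4 (- e).
- by apply/andP; split; lra.
- by lra.
- by move=> y; rewrite !inE => /or4P[]/eqP->.
exists y1, y2, y3, y4, (4 * - e); split=> //; split; last by lra.
by apply/and4P; split; lra.
Qed.
End RootShift.

(** * Sorted vectors *)

Section SortedVectors.
Variable R : realType.

Lemma nneg_noninc_sort (d : nat) (v : 'rV[R]_d) : (forall i, 0 <= v 0 i) ->
  exists2 w : 'rV[R]_d, nneg_noninc w & forall k, psum k w = psum k v.
Proof.
move=> v0; pose s := sort (fun x y : R => y <= x) [seq v 0 i | i <- enum 'I_d].
have szs : size s = d by rewrite size_sort size_map size_enum_ord.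
exists (\row_i s`_i); last first.
  move=> k; rewrite /psum (eq_bigr (fun i : 'I_d => s`_i ^+ k)) => [|i _];
    last by rewrite mxE.
  rewrite -(big_mkord xpredT (fun i => s`_i ^+ k)) -[in index_iota _ _]szs.
  rewrite -(big_nth 0 xpredT (fun x => x ^+ k)).
  rewrite (perm_big [seq v 0 i | i <- enum 'I_d]) /=; last by rewrite perm_sort.
  by rewrite big_map big_enum.
split=> [i|i j ij]; rewrite !mxE.
  have /mapP[j _ ->] : s`_i \in [seq v 0 i | i <- enum 'I_d].
    by rewrite -(mem_sort (fun x y : R => y <= x)) mem_nth ?szs.
  exact: v0.
have srt : sorted (fun x y : R => y <= x) s.
  by apply: sort_sorted => x y; exact: le_total.
apply: (@sorted_leq_nth _ (fun x y : R => y <= x)); rewrite ?inE ?szs //.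
  by move=> y x z xy yz; exact: le_trans yz xy.
Qed.

Definition replace (d : nat) (v : 'rV[R]_d) (idx : seq 'I_d) (ys : seq R) :=
  \row_i (if i \in idx then ys`_(index i idx) else v 0 i).

(** With [g] a power function, this carries the identities on three or four shifted entries over to
    the power sums of the whole vector. *)
Lemma sum_replace (d : nat) (v : 'rV[R]_d) (idx : seq 'I_d) (ys : seq R)
    (g : R -> R) : uniq idx -> size ys = size idx ->
  \sum_i g (replace v idx ys 0 i) + \sum_(i <- idx) g (v 0 i)
    = \sum_i g (v 0 i) + \sum_(y <- ys) g y.
Proof.
move=> uidx szys.
rewrite (bigID (mem idx)) [in RHS](bigID (mem idx)) /= -!(big_uniq _ uidx) /=.
have -> : \sum_(i <- idx) g (replace v idx ys 0 i) = \sum_(y <- ys) g y.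
  case: idx uidx szys => [_ /size0nil ->|i0 idx']; first by rewrite !big_nil.
  set idx := i0 :: idx' => uidx szys; rewrite (big_nth i0) (big_nth (0 : R)) szys.
  rewrite big_nat [RHS]big_nat; apply: eq_bigr => k /andP[_ k_lt].
  by rewrite mxE mem_nth // index_uniq.
rewrite (eq_bigr (fun i => g (v 0 i))) => [|i /negPf iN]; last by rewrite mxE iN.
by ring.
Qed.

Lemma replace_ge0 (d : nat) (v : 'rV[R]_d) (idx : seq 'I_d) (ys : seq R) :
  (forall i, 0 <= v 0 i) -> all (fun y => 0 <= y) ys ->
  forall i, 0 <= replace v idx ys 0 i.
Proof.
move=> v0 ys0 i; rewrite mxE; case: ifP => // _.
have [lt|ge] := ltnP (index i idx) (size ys); last by rewrite nth_default.
exact: (allP ys0 _ (mem_nth 0 lt)).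
Qed.

Section Profile.
Variables (d : nat) (v : 'rV[R]_d) (hv : nneg_noninc v).

(** Extension by zero lets positions be arbitrary natural numbers; since the entries are
    non-negative, the extended sequence is still non-increasing. *)
Definition entry (n : nat) : R := if insub n is Some i then v 0 i else 0.

Lemma entryE (i : 'I_d) : entry i = v 0 i.
Proof. by rewrite /entry valK. Qed.

Lemma entry_default n : (d <= n)%N -> entry n = 0.
Proof. by move=> dn; rewrite /entry insubN // -leqNgt. Qed.

Lemma entry_ge0 n : 0 <= entry n.
Proof. by rewrite /entry; case: insub => // i; case: hv. Qed.

Lemma entry_noninc m n : (m <= n)%N -> entry n <= entry m.
Proof.
move=> mn; have [nd|dn] := ltnP n d; last by rewrite entry_default ?entry_ge0.
rewrite -[n]/(val (Ordinal nd)) -[m]/(val (Ordinal (leq_ltn_trans mn nd))).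
by rewrite !entryE; case: hv => _; apply.
Qed.

(** Let [n] be the first position of a zero. If the entries at positions 1 to [n - 2] agree, they
    form the block of [b]'s. Otherwise one of them, at [i], is less than the entry at 1, and
    positions 0, 1, [i], [n - 1] suit [quartic_increase]. *)
Lemma max_form_or_increasable : (2 <= d)%N ->
  max_form v \/ exists i j k l : 'I_d,
    [/\ uniq [:: i; j; k; l], v 0 j <= v 0 i, v 0 k < v 0 j,
        v 0 l <= v 0 k & 0 < v 0 l].
Proof.
move=> d2.
have ex0 : exists n, entry n == 0 by exists d; rewrite entry_default.
case: (ex_minnP ex0) => n /eqP en0 nmin.
have nd : (n <= d)%N by apply: nmin; rewrite entry_default.
have b2d : (n.-2.+2 <= d)%N by case: n nd {en0 nmin} => [|[|n]].
have [/forallP flat|] :=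
    boolP [forall i : 'I_d, (1 <= i <= n.-2)%N ==> (v 0 i == entry 1)].
  (* For [n <= 2] the truncated [n.-2] is 0: the block of [b]'s is empty, and [c] is [entry 1],
     possibly zero. *)
  left; exists n.-2, (entry 0), (entry 1), (entry n.-2.+1); split=> //.
  apply/rowP => i; rewrite mxE; case: eqP => [i0|/eqP i0].
    by rewrite -entryE i0.
  case: ifP => [ib|ib].
    by have := flat i; rewrite lt0n i0 ib => /eqP.
  case: eqP => [i1|/eqP i1]; first by rewrite -entryE i1.
  apply/eqP; rewrite -entryE eq_le entry_ge0 andbT -en0.
  by apply: entry_noninc; lia.
rewrite negb_forall => /existsP[i +].
rewrite negb_imply => /andP[/andP[i1 ib] vi]; right.
have i2 : (1 < i)%N.
  rewrite ltn_neqAle i1 andbT; apply: contraNneq vi => e1.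
  by rewrite -entryE -e1.
have ln : (n.-1 < d)%N by lia.
exists (Ordinal (ltnW d2)), (Ordinal d2), i, (Ordinal ln).
have val0 : v 0 (Ordinal (ltnW d2)) = entry 0 by rewrite -entryE.
have val1 : v 0 (Ordinal d2) = entry 1 by rewrite -entryE.
have vall : v 0 (Ordinal ln) = entry n.-1 by rewrite -entryE.
rewrite val0 val1 vall; split.
- by rewrite /= !inE -!val_eqE /=; apply/and4P; split; lia.
- exact: entry_noninc.
- by rewrite lt_neqAle vi -entryE entry_noninc.
- by rewrite -entryE entry_noninc //; lia.
- rewrite lt_neqAle entry_ge0 andbT eq_sym.
  by apply: contraTneq isT => /eqP /nmin; lia.
Qed.

(** Let [n] be the first position whose entry differs from the first one, capped at [d - 1] to cover
    constant vectors. Either all later entries equal the last one, or some [i] exceeds it and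
    positions 0, [n], [i], [d - 1] suit [quartic_decrease]. *)
Lemma min_form_or_decreasable : (2 <= d)%N ->
  min_form v \/ exists i j k l : 'I_d,
    [/\ uniq [:: i; j; k; l], v 0 j < v 0 i, v 0 k <= v 0 j,
        v 0 l < v 0 k & 0 <= v 0 l].
Proof.
move=> d2.
have ex0 : exists n, (entry n != entry 0) || (d.-1 <= n)%N.
  by exists d.-1; rewrite leqnn orbT.
case: (ex_minnP ex0) => n ne nmin.
have nd : (n <= d.-1)%N by apply: nmin; rewrite leqnn orbT.
have n0 : (0 < n)%N.
  by rewrite lt0n; apply: contraTneq ne => ->; rewrite eqxx /=; lia.
have ld : (d.-1 < d)%N by lia.
have [/forallP flat|] :=
    boolP [forall i : 'I_d, (n < i)%N ==> (v 0 i == entry d.-1)].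
  left; exists n, (entry 0), (entry n), (entry d.-1); split; first by rewrite n0.
  apply/rowP => i; rewrite mxE; case: ifP => [ib|ib].
    rewrite -entryE; apply/eqP; apply: contraTT ib => ie.
    by rewrite -leqNgt nmin // ie.
  case: eqP => [<-|/eqP i1]; first by rewrite -entryE.
  by apply/eqP; have /implyP := flat i; apply; lia.
rewrite negb_forall => /existsP[i +]; rewrite negb_imply => /andP[ni vi]; right.
have il : (i < d.-1)%N.
  rewrite ltn_neqAle; apply/andP; split; last by have := ltn_ord i; lia.
  by apply: contraNneq vi => <-; rewrite entryE.
have nld : (n < d)%N by lia.
exists (Ordinal (ltnW d2)), (Ordinal nld), i, (Ordinal ld).
have val0 : v 0 (Ordinal (ltnW d2)) = entry 0 by rewrite -entryE.
have valn : v 0 (Ordinal nld) = entry n by rewrite -entryE.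
have vall : v 0 (Ordinal ld) = entry d.-1 by rewrite -entryE.
rewrite val0 valn vall; split.
- by rewrite /= !inE -!val_eqE /=; apply/and4P; split; lia.
- rewrite lt_neqAle entry_noninc // andbT.
  by case/orP: ne => // dn; exfalso; lia.
- by rewrite -entryE entry_noninc // ltnW.
- by rewrite lt_neqAle eq_sym vi -entryE entry_noninc // ltnW.
- exact: entry_ge0.
Qed.

Lemma head_form_or_increasable : (2 <= d)%N ->
  (exists a b : R, v = \row_(i < d) (if i == 0%N :> nat then a else b)) \/
  exists i j k : 'I_d,
    [/\ uniq [:: i; j; k], v 0 j <= v 0 i, v 0 k < v 0 j & 0 <= v 0 k].
Proof.
move=> d2.
have [/forallP flat|] :=
    boolP [forall i : 'I_d, (0 < i)%N ==> (v 0 i == entry 1)].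
  left; exists (entry 0), (entry 1); apply/rowP => i; rewrite mxE.
  case: eqP => [i0|/eqP i0]; first by rewrite -entryE i0.
  by have := flat i; rewrite lt0n i0 => /eqP.
rewrite negb_forall => /existsP[i +]; rewrite negb_imply => /andP[i0 vi]; right.
have i2 : (1 < i)%N.
  rewrite ltn_neqAle i0 andbT; apply: contraNneq vi => e1.
  by rewrite -entryE -e1.
exists (Ordinal (ltnW d2)), (Ordinal d2), i.
have val0 : v 0 (Ordinal (ltnW d2)) = entry 0 by rewrite -entryE.
have val1 : v 0 (Ordinal d2) = entry 1 by rewrite -entryE.
rewrite val0 val1; split.
- by rewrite /= !inE -!val_eqE /=; apply/and3P; split; lia.
- exact: entry_noninc.
- by rewrite lt_neqAle vi -entryE entry_noninc.
- by case: hv.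
Qed.
End Profile.
End SortedVectors.

(** * Uniqueness *)

Section Uniqueness.
Variables (R : realType) (d : nat).
Implicit Types v w : 'rV[R]_d.

(** The derivative of [G] is [6 * (t - s1) * (t - s2)], so [G] increases strictly on each side of
    the interval from [s1] to [s2]. The [?= iff] form records strictness. *)
Lemma primitive_increases (s1 s2 x y : R) (G : R -> R) :
  (forall t, G t = 2 * t ^+ 3 - 3 * (s1 + s2) * t ^+ 2 + 6 * (s1 * s2) * t) ->
  s1 <= s2 -> y <= x -> s2 <= y \/ x <= s1 -> 0 <= G x - G y ?= iff (x == y).
Proof.
move=> GE s12; rewrite le_eqVlt => /orP[/eqP->|yx] bnd.
  by rewrite subrr eqxx; exact/leif_refl.
rewrite gt_eqF //; apply/leifP; rewrite !GE.
set a := x - s2; set b := y - s2; set k := s2 - s1.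
have [ab k0] : b < a /\ 0 <= k by rewrite /a /b /k; split; lra.
suff : 0 < (a - b) * (2 * (a ^+ 2 + a * b + b ^+ 2) + 3 * k * (a + b)).
  rewrite /a /b /k; congr (0 < _); ring.
apply: mulr_gt0; first by rewrite subr_gt0.
case: bnd => bnd.
  have b0 : 0 <= b by rewrite /b; lra.
  have a0 : 0 < a by lra.
  apply: ltr_wpDr; first by rewrite !mulr_ge0 //; lra.
  rewrite pmulr_rgt0 // -addrA ltr_wpDr ?exprn_gt0 //.
  by rewrite addr_ge0 ?mulr_ge0 ?exprn_ge0 // ltW.
have ak : a <= - k by rewrite /a /k; lra.
(* The reflection exchanging [s1] and [s2] reduces this side to the previous one: [a'] is [s1 - x]
   and [b'] is [s1 - y], and the second factor is invariant. *)
set a' := - a - k; set b' := - b - k.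
have a'0 : 0 <= a' by rewrite /a'; lra.
have b'0 : a' < b' by rewrite /a' /b'; lra.
have -> : 2 * (a ^+ 2 + a * b + b ^+ 2) + 3 * k * (a + b) =
   2 * (a' ^+ 2 + a' * b' + b' ^+ 2) + 3 * k * (a' + b').
  by rewrite /a' /b'; ring.
have b'1 : 0 < b' by lra.
apply: ltr_wpDr; first by rewrite !mulr_ge0 //; lra.
by rewrite pmulr_rgt0 // ltr_wpDl ?exprn_gt0 // addr_ge0 ?mulr_ge0 ?exprn_ge0 // ltW.
Qed.

Lemma primitive_decreases (s1 s2 x y : R) (G : R -> R) :
  (forall t, G t = 2 * t ^+ 3 - 3 * (s1 + s2) * t ^+ 2 + 6 * (s1 * s2) * t) ->
  s1 <= x -> x <= y -> y <= s2 -> 0 <= G x - G y ?= iff (x == y).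
Proof.
move=> GE s1x; rewrite le_eqVlt => /orP[/eqP->|xy] ys2.
  by rewrite subrr eqxx; exact/leif_refl.
rewrite lt_eqF //; apply/leifP; rewrite !GE.
set a := x - s1; set b := y - s1; set k := s2 - s1.
have [ab a0 bk] : [/\ a < b, 0 <= a & b <= k] by rewrite /a /b /k; split; lra.
suff : 0 < (b - a) * (3 * (k - b) * (a + b) + (b - a) * (b + 2 * a)).
  rewrite /a /b /k; congr (0 < _); ring.
apply: mulr_gt0; first by rewrite subr_gt0.
apply: ltr_wpDl; first by rewrite !mulr_ge0 //; lra.
by apply: mulr_gt0; lra.
Qed.

(* The sign pattern (+, -, +) of v - w is killed by the cubic whose derivative
   vanishes at the two levels where the sign changes. *)
Lemma eq_of_two_sign_changes v w (i1 i2 : nat) :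
  nneg_noninc v -> nneg_noninc w -> (i1 <= i2)%N ->
  (forall i : 'I_d, (i < i1)%N -> w 0 i <= v 0 i) ->
  (forall i : 'I_d, (i1 <= i < i2)%N -> v 0 i <= w 0 i) ->
  (forall i : 'I_d, (i2 <= i)%N -> w 0 i <= v 0 i) ->
  psum 1 v = psum 1 w -> psum 2 v = psum 2 w -> psum 3 v = psum 3 w -> v = w.
Proof.
move=> hv hw i12 h1 h2 h3 p1 p2 p3.
(* Non-negative terms with zero sum all vanish, and the equality case of [hG] then gives [v = w]
   entrywise. *)
suff [G sG hG] : exists2 G : R -> R, \sum_i (G (v 0 i) - G (w 0 i)) = 0 &
    forall i, 0 <= G (v 0 i) - G (w 0 i) ?= iff (v 0 i == w 0 i).
  have /psumr_eq0P := sG => z; apply/rowP => i; apply/eqP.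
  by rewrite -(hG i).2 eq_sym z // => j _; exact: (hG j).1.
(* If the middle range is empty, [v] dominates [w] everywhere, and the identity serves as [G]. *)
move: i12; rewrite leq_eqVlt => /orP[/eqP i12|i12].
  have wv i : w 0 i <= v 0 i.
    by have [/h1|ge] := ltnP i i1; last by apply: h3; rewrite -i12.
  exists id => [|i]; last by split; rewrite ?subr_ge0 // eq_sym subr_eq0.
  rewrite sumrB; apply/eqP; rewrite subr_eq0; apply/eqP.
  by move: p1; rewrite /psum; under eq_bigr do rewrite expr1;
     under [RHS]eq_bigr do rewrite expr1.
(* By monotonicity both vectors have entries at least [s2] before [i1], between [s1] and [s2] in the
   middle range, and at most [s1] from [i2] on, so [G] is monotone in the required direction on each
   range. *)
pose s1 := entry v i2; pose s2 := entry w i1.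
pose G (t : R) := 2 * t ^+ 3 - 3 * (s1 + s2) * t ^+ 2 + 6 * (s1 * s2) * t.
have s12 : s1 <= s2.
  have [id1|di1] := ltnP i1 d.
    apply: (@le_trans _ _ (entry v i1)); first exact/entry_noninc/ltnW.
    rewrite /s2 -[i1]/(val (Ordinal id1)) !entryE; apply: h2.
    by rewrite /= leqnn.
  rewrite /s1 entry_default ?entry_ge0 //; exact: leq_trans di1 (ltnW i12).
exists G => [|i].
  have -> : \sum_i (G (v 0 i) - G (w 0 i)) =
      2 * (psum 3 v - psum 3 w) - 3 * (s1 + s2) * (psum 2 v - psum 2 w)
      + 6 * (s1 * s2) * (psum 1 v - psum 1 w).
    rewrite /psum -!sumrB !mulr_sumr -sumrB -big_split /=.
    by apply: eq_bigr => i _; rewrite /G; ring.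
  by rewrite p1 p2 p3 !subrr !mulr0 subr0 addr0.
have [lt1|ge1] := ltnP i i1.
  apply: (@primitive_increases s1 s2) => //; first exact: h1.
  by left; rewrite -entryE /s2; apply: entry_noninc => //; exact: ltnW.
have [lt2|ge2] := ltnP i i2.
  apply: (@primitive_decreases s1 s2) => //.
  - by rewrite -entryE; apply: entry_noninc => //; exact: ltnW.
  - by apply: h2; rewrite ge1.
  - by rewrite -entryE; apply: entry_noninc.
apply: (@primitive_increases s1 s2) => //; first exact: h3.
by right; rewrite -entryE; apply: entry_noninc.
Qed.

(** Nothing is assumed at position 0: depending on the sign there, it joins the middle range or
    forms the first range alone. *)
Lemma eq_of_tail_sign_change v w (m : nat) :
  nneg_noninc v -> nneg_noninc w -> (0 < m)%N ->
  (forall i : 'I_d, (0 < i < m)%N -> v 0 i <= w 0 i) ->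
  (forall i : 'I_d, (m <= i)%N -> w 0 i <= v 0 i) ->
  psum 1 v = psum 1 w -> psum 2 v = psum 2 w -> psum 3 v = psum 3 w -> v = w.
Proof.
move=> hv hw m0 h1 h2.
have [vw|wv] := lerP (entry v 0) (entry w 0).
  apply: (@eq_of_two_sign_changes v w 0 m) => // i /andP[_ im].
  have [i0|i0] := posnP i; last by apply: h1; rewrite i0.
  by rewrite -!entryE i0.
apply: (@eq_of_two_sign_changes v w 1 m) => // i.
rewrite ltnS leqn0 => /eqP i0.
by rewrite -!entryE i0 ltW.
Qed.

(** Past position 0 the sign of [v - w] changes at most once, so [eq_of_tail_sign_change] applies;
    the case analysis locates the change. *)
Lemma max_form_unique v w :
  max_form v -> nneg_noninc v -> max_form w -> nneg_noninc w ->
  psum 1 v = psum 1 w -> psum 2 v = psum 2 w -> psum 3 v = psum 3 w -> v = w.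
Proof.
move=> [n [a [b [c [nd vE]]]]] hv [n' [a' [b' [c' [nd' wE]]]]] hw.
wlog : v w n a b c nd vE hv n' a' b' c' nd' wE hw / (n' <= n)%N => [wl|nn'].
  case/orP: (leq_total n' n) => nn' p1 p2 p3.
    exact: (wl v w n a b c nd vE hv n' a' b' c').
  by apply/esym; apply: (wl w v n' a' b' c' nd' wE hw n a b c).
have vi i : v 0 i = if i == 0%N :> nat then a else if (i <= n)%N then b
    else if i == n.+1 :> nat then c else 0 by rewrite vE mxE.
have wi i : w 0 i = if i == 0%N :> nat then a' else if (i <= n')%N then b'
    else if i == n'.+1 :> nat then c' else 0 by rewrite wE mxE.
have d1 : (1 < d)%N by lia.
have [ln ln'] : (n.+1 < d)%N /\ (n'.+1 < d)%N by [].
have v1 := vi (Ordinal d1); have vn := vi (Ordinal ln).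
have w1 := wi (Ordinal d1); have wn' := wi (Ordinal ln').
have cb : (0 < n)%N -> 0 <= c <= b.
  move=> n0; have := hv.1 (Ordinal ln); have := hv.2 (Ordinal d1) (Ordinal ln) isT.
  by rewrite vn v1 /= n0 ltnn eqxx => -> ->.
have cb' : (0 < n')%N -> c' <= b'.
  move=> n0; have := hw.2 (Ordinal d1) (Ordinal ln') isT.
  by rewrite wn' w1 /= n0 ltnn eqxx.
have c0 : 0 <= c.
  by have := hv.1 (Ordinal ln); rewrite vn /= ltnn eqxx.
clear v1 vn w1 wn' vE wE.
move: nn'; rewrite leq_eqVlt => /orP[/eqP nn'|nn'] p1 p2 p3.
  subst n'.
  have [bb|bb] := lerP b b'; have [cc|cc] := lerP c c'.
  - apply: (@eq_of_tail_sign_change v w d) => //; first by lia.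
      by move=> i /andP[i0 _]; rewrite vi wi; do ![case: ifP => ? //];
      ((exfalso; lia) || lra).
    by move=> i; have := ltn_ord i; lia.
  - apply: (@eq_of_tail_sign_change v w n.+1) => // i hi {p1 p2 p3}; rewrite vi wi;
      by do ![case: ifP => ? //]; ((exfalso; lia) || lra).
  - apply/esym; apply: (@eq_of_tail_sign_change w v n.+1) => // i hi {p1 p2 p3};
      rewrite vi wi; by do ![case: ifP => ? //]; ((exfalso; lia) || lra).
  - apply: (@eq_of_tail_sign_change v w 1) => // i hi {p1 p2 p3}; rewrite vi wi;
      by do ![case: ifP => ? //]; ((exfalso; lia) || lra).
(* Here [v] has the longer block. It dominates [w] from position [n' + 2] on, where [w] is zero, so
   only [b] against [b'] and [c'] remains to be compared. *)
have n0 : (0 < n)%N by lia.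
have /andP[_ {}cb] := cb n0.
have [cb1|bc] := lerP c' b.
  have [bb|bb] := lerP b b'.
    by apply: (@eq_of_tail_sign_change v w n'.+1) => // i hi {p1 p2 p3}; rewrite vi wi;
      do ![case: ifP => ? //]; ((exfalso; lia) || lra).
  by apply: (@eq_of_tail_sign_change v w 1) => // i hi {p1 p2 p3}; rewrite vi wi;
    do ![case: ifP => ? //]; ((exfalso; lia) || lra).
apply: (@eq_of_tail_sign_change v w n'.+2) => // i hi {p1 p2 p3}; rewrite vi wi;
  do ![case: ifP => ? //]; try ((exfalso; lia) || lra).
by have := cb' ltac:(lia); lra.
Qed.

(** For equal block lengths only three comparisons matter, and three signs change at most twice.
    Otherwise [w] is constant before [n'] and [v] is constant from [n'] on, which leaves one sign
    change on each side. *)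
Lemma min_form_unique v w :
  min_form v -> nneg_noninc v -> min_form w -> nneg_noninc w ->
  psum 1 v = psum 1 w -> psum 2 v = psum 2 w -> psum 3 v = psum 3 w -> v = w.
Proof.
move=> [n [a [b [c [nd vE]]]]] hv [n' [a' [b' [c' [nd' wE]]]]] hw.
wlog : v w n a b c nd vE hv n' a' b' c' nd' wE hw / (n <= n')%N => [wl|nn'].
  case/orP: (leq_total n n') => nn' p1 p2 p3.
    exact: (wl v w n a b c nd vE hv n' a' b' c').
  by apply/esym; apply: (wl w v n' a' b' c' nd' wE hw n a b c).
have vi i : v 0 i = if (i < n)%N then a else if i == n :> nat then b
    else c by rewrite vE mxE.
have wi i : w 0 i = if (i < n')%N then a' else if i == n' :> nat then b'
    else c' by rewrite wE mxE.
move: nn'; rewrite leq_eqVlt => /orP[/eqP nn'|nn'] p1 p2 p3.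
  subst n'.
  have [aa|aa] := lerP a a'; have [bb|bb] := lerP b b';
    have [cc|cc] := lerP c c'.
  - by apply: (@eq_of_two_sign_changes v w 0 d) => // i hi {p1 p2 p3}; rewrite vi wi;
      do ![case: ifP => ? //]; (lra || (exfalso; have := ltn_ord i; lia)).
  - by apply: (@eq_of_two_sign_changes v w 0 n.+1) => // i hi {p1 p2 p3}; rewrite vi wi;
      do ![case: ifP => ? //]; (lra || (exfalso; have := ltn_ord i; lia)).
  - apply/esym; apply: (@eq_of_two_sign_changes w v n n.+1) => // i hi {p1 p2 p3};
      by rewrite vi wi;
      do ![case: ifP => ? //]; (lra || (exfalso; have := ltn_ord i; lia)).
  - by apply: (@eq_of_two_sign_changes v w 0 n) => // i hi {p1 p2 p3}; rewrite vi wi;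
      do ![case: ifP => ? //]; (lra || (exfalso; have := ltn_ord i; lia)).
  - by apply: (@eq_of_two_sign_changes v w n d) => //;
      [lia | | |] => i hi {p1 p2 p3}; rewrite vi wi;
      do ![case: ifP => ? //]; (lra || (exfalso; have := ltn_ord i; lia)).
  - by apply: (@eq_of_two_sign_changes v w n n.+1) => // i hi {p1 p2 p3}; rewrite vi wi;
      do ![case: ifP => ? //]; (lra || (exfalso; have := ltn_ord i; lia)).
  - by apply: (@eq_of_two_sign_changes v w n.+1 d) => //;
      [lia | | |] => i hi {p1 p2 p3}; rewrite vi wi;
      do ![case: ifP => ? //]; (lra || (exfalso; have := ltn_ord i; lia)).
  - by apply: (@eq_of_two_sign_changes v w 0 0) => // i hi {p1 p2 p3}; rewrite vi wi;
      do ![case: ifP => ? //]; (lra || (exfalso; have := ltn_ord i; lia)).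
have [nd1 nd'1 nS] : [/\ (n < d)%N, (n' < d)%N & (n.+1 < d)%N] by split; lia.
have [ba cb] : b <= a /\ c <= b.
  have n1d : (n.-1 < d)%N by lia.
  have := hv.2 (Ordinal n1d) (Ordinal nd1) (leq_pred n).
  have := hv.2 (Ordinal nd1) (Ordinal nS) (leqnSn n).
  rewrite !vi /= ltnn eqxx ltnNge leqnSn /= gtn_eqF //=.
  by rewrite ifT //; lia.
have ba' : b' <= a'.
  have n1d : (n'.-1 < d)%N by lia.
  have := hw.2 (Ordinal n1d) (Ordinal nd'1) (leq_pred n').
  by rewrite !wi /= ltnn eqxx ifT //; lia.
have cb' : (n'.+1 < d)%N -> c' <= b'.
  move=> nS'; have := hw.2 (Ordinal nd'1) (Ordinal nS') (leqnSn n').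
  by rewrite !wi /= ltnn eqxx ltnNge leqnSn /= gtn_eqF.
(* The first change: [i1] is where the non-increasing [v] passes below the level [a'], capped at
   [n']. *)
have [i1 [i1n head1 head2]] : exists i1, [/\ (i1 <= n')%N,
    forall i : 'I_d, (i < i1)%N -> a' <= v 0 i &
    forall i : 'I_d, (i1 <= i)%N -> v 0 i <= a' \/ (n' <= i)%N].
  have [aa|aa] := lerP a a'.
    exists 0%N; split=> // i hi; left; rewrite vi.
    by do ![case: ifP => ? //]; lra.
  have [bb|bb] := lerP b a'.
    exists n; split=> [||i hi]; first exact: ltnW.
      by move=> i hi; rewrite vi hi ltW.
    left; rewrite vi; do ![case: ifP => ? //]; try lra; exfalso; lia.
  have [cc|cc] := lerP c a'.
    exists n.+1; split=> // [i hi|i hi].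
      rewrite vi; do ![case: ifP => ? //]; try lra; exfalso; lia.
    left; rewrite vi; do ![case: ifP => ? //]; try lra; exfalso; lia.
  exists n'; split=> // [i hi|i hi]; last by right.
  by rewrite vi; do ![case: ifP => ? //]; lra.
have low (m : nat) (i : 'I_d) : (i1 <= i < m)%N ->
    ((n' < m)%N -> c <= b') -> ((n'.+1 < m)%N -> c <= c') -> v 0 i <= w 0 i.
  move=> /andP[/head2 hi im] cb1 cc1; rewrite wi.
  have [lt|ge] := ltnP i n'; first by case: hi => //; lia.
  rewrite vi [(i < n)%N]ltnNge (leq_trans (ltnW nn') ge) /=.
  rewrite gtn_eqF ?(leq_trans nn') //.
  case: ifP => [/eqP e|ne]; first by apply: cb1; lia.
  by apply: cc1; lia.
have mid (i : 'I_d) : (i < i1)%N -> w 0 i <= v 0 i.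
  by move=> hi; rewrite wi (leq_trans hi i1n); exact: head1.
have tail (m : nat) (i : 'I_d) : (n' <= m)%N -> (m <= i)%N ->
    (m = n' -> b' <= c) -> ((n' < i)%N -> c' <= c) -> w 0 i <= v 0 i.
  move=> n'm mi cb1 cc1; rewrite wi ltnNge (leq_trans n'm mi) /=.
  have lt : (n < i)%N by lia.
  rewrite vi ltnNge (ltnW lt) /= (gtn_eqF lt).
  case: ifP => [/eqP e|ne]; first by apply: cb1; lia.
  by apply: cc1; lia.
(* The second change occurs where [w] falls to the constant [c] or below: at [n'], at [n' + 1], or
   never, in which case [d] is taken. *)
have [b'c|cb1] := lerP b' c.
  apply: (@eq_of_two_sign_changes v w i1 n') => // i hi.
    by apply: (low n') => //; lia.
  apply: (tail n') => // lt.
  by apply: le_trans (cb' _) b'c; have := ltn_ord i; lia.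
have [c'c|cc1] := lerP c' c.
  apply: (@eq_of_two_sign_changes v w i1 n'.+1) => //; first exact: leqW.
    by move=> i hi; apply: (low n'.+1) => // [|]; [move=> _; exact: ltW|lia].
  by move=> i hi; apply: (tail n'.+1) => //; lia.
apply: (@eq_of_two_sign_changes v w i1 d) => //; first by lia.
  by move=> i hi; apply: (low d) => // _; exact: ltW.
by move=> i hi; have := ltn_ord i; lia.
Qed.
End Uniqueness.

(** * Extremal vectors and attained power sums *)

Section Extremals.
Variables (R : realType) (d : nat).
Implicit Types v w : 'rV[R]_d.
Local Open Scope classical_set_scope.

Lemma psum_continuous k : continuous (@psum R d k).
Proof.
rewrite /psum; apply: continuous_big => [|i _ v]; first exact: add_continuous.
apply: (@continuous_comp _ _ _ (fun v : 'rV[R]_d => v 0 i) (fun x => x ^+ k)).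
  exact: coord_continuous.
exact: exprn_continuous.
Qed.

Lemma closed_psum k (D : set R) : closed D ->
  closed [set v : 'rV[R]_d | D (psum k v)].
Proof. by apply: preimage_closed => v _; exact: psum_continuous. Qed.

Lemma closed_nneg : closed [set v : 'rV[R]_d | forall i, 0 <= v 0 i].
Proof.
rewrite [X in closed X](_ : _ =
    \bigcap_(i in setT) ((fun v => v 0 i) @^-1` [set x | 0 <= x])); last first.
  by apply/seteqP; split=> v h i; [move=> _; exact: h|exact: h].
apply: closed_bigI => i _; apply: preimage_closed; last exact: closed_ge.
by move=> v _; exact: coord_continuous.
Qed.

(** Non-negative entries with sum 1 lie in the unit interval, so [A] is a closed subset of a compact
    cube. *)
Lemma compact_in_simplex (A : set 'rV[R]_d) : closed A ->
  (forall v, A v -> (forall i, 0 <= v 0 i) /\ psum 1 v = 1) -> compact A.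
Proof.
move=> clA A1; have cI (i : 'I_d) : compact `[0, 1 : R] by exact: segment_compact.
apply: subclosed_compact clA (rV_compact cI) _ => v /A1[v0 v1] i /=.
rewrite in_itv /= v0 -v1 /psum (bigD1 i) //= expr1 lerDl.
by apply: sumr_ge0 => j _; rewrite expr1.
Qed.

Lemma psum_argmax (A : set 'rV[R]_d) k : closed A -> A !=set0 ->
  (forall v, A v -> (forall i, 0 <= v 0 i) /\ psum 1 v = 1) ->
  exists2 v, A v & forall w, A w -> psum k w <= psum k v.
Proof.
move=> clA A0 A1.
have [||v vA vmax] := @EVT_max_rV R d (psum k) A A0.
- exact: compact_in_simplex.
- exact/continuous_subspaceT/psum_continuous.
by exists v => [|w wA]; [rewrite inE in vA|apply: vmax; rewrite inE].
Qed.

Lemma psum_argmin (A : set 'rV[R]_d) k : closed A -> A !=set0 ->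
  (forall v, A v -> (forall i, 0 <= v 0 i) /\ psum 1 v = 1) ->
  exists2 v, A v & forall w, A w -> psum k v <= psum k w.
Proof.
move=> clA A0 A1.
have [||v vA vmin] := @EVT_min_rV R d (psum k) A A0.
- exact: compact_in_simplex.
- exact/continuous_subspaceT/psum_continuous.
by exists v => [|w wA]; [rewrite inE in vA|apply: vmin; rewrite inE].
Qed.

(** Maximize over the part of [A] at or below level [t]: a maximizer strictly below [t] could be
    improved without leaving that part. This replaces a connectedness argument. *)
Lemma psum_attained (A : set 'rV[R]_d) k v0 (t : R) : closed A ->
  (forall v, A v -> (forall i, 0 <= v 0 i) /\ psum 1 v = 1) ->
  A v0 -> psum k v0 <= t ->
  (forall v, A v -> psum k v < t ->
     exists2 w, A w & psum k v < psum k w <= t) ->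
  exists2 v, A v & psum k v = t.
Proof.
move=> clA A1 Av0 v0t improve.
have [|||v [vA vt] vmax] := @psum_argmax (A `&` [set v | psum k v <= t]) k.
- apply: closedI; first exact: clA.
  exact: (@closed_psum k [set x | x <= t] (@closed_le _ t)).
- by exists v0.
- by move=> v [/A1].
exists v => //; apply/eqP; rewrite eq_le vt leNgt /=; apply/negP => lt.
have [w wA /andP[vw wt]] := improve v vA lt.
by have := vmax w (conj wA wt); rewrite leNgt vw.
Qed.

Definition moments2 (p2 : R) : set 'rV[R]_d :=
  [set v : 'rV[R]_d | [/\ forall i, 0 <= v 0 i, psum 1 v = 1 & psum 2 v = p2]].

Definition moments3 (p2 p3 : R) : set 'rV[R]_d :=
  moments2 p2 `&` [set v : 'rV[R]_d | psum 3 v = p3].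

Lemma closed_moments2 p2 : closed (moments2 p2).
Proof.
rewrite /moments2 [X in closed X](_ : _ =
  [set v : 'rV[R]_d | forall i, 0 <= v 0 i] `&`
  ([set v : 'rV[R]_d | psum 1 v = 1] `&` [set v : 'rV[R]_d | psum 2 v = p2])).
  apply: closedI; first exact: closed_nneg.
  apply: closedI; first exact: (@closed_psum 1 [set x | x = 1] (@closed_eq _ 1)).
  exact: (@closed_psum 2 [set x | x = p2] (@closed_eq _ p2)).
by apply/seteqP; split=> v; [case|case=> ? []].
Qed.

Lemma closed_moments3 p2 p3 : closed (moments3 p2 p3).
Proof.
apply: closedI; first exact: closed_moments2.
exact: (@closed_psum 3 [set x | x = p3] (@closed_eq _ p3)).
Qed.

Lemma moments3_simplex p2 p3 v :
  moments3 p2 p3 v -> (forall i, 0 <= v 0 i) /\ psum 1 v = 1.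
Proof. by case=> [[]]. Qed.

Lemma moments2_sort p2 v : moments2 p2 v ->
  exists w, [/\ nneg_noninc w, moments2 p2 w & forall k, psum k w = psum k v].
Proof.
move=> [v0 v1 v2]; have [w hw kw] := nneg_noninc_sort v0.
by exists w; split=> //; split; rewrite ?kw //; case: hw.
Qed.

Lemma moments3_sort p2 p3 v : moments3 p2 p3 v ->
  exists w, [/\ nneg_noninc w, moments3 p2 p3 w & forall k, psum k w = psum k v].
Proof.
move=> [/moments2_sort[w [hw mw kw]] v3].
by exists w; split=> //; split=> //; rewrite /= kw.
Qed.

Lemma moments3_has_psums p2 p3 v : nneg_noninc v ->
  moments3 p2 p3 v <-> has_psums 1 p2 p3 v.
Proof. by move=> [v0 _]; split=> [[[]]|[]]. Qed.

(** The cap [e] on the gain lets [psum_attained] approach a target without overshooting it. *)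
Lemma increase_psum3 p2 v (e : R) : (2 <= d)%N -> 0 < e ->
  nneg_noninc v -> moments2 p2 v ->
  (exists a b : R, v = \row_(i < d) (if i == 0%N :> nat then a else b)) \/
  exists2 w : 'rV[R]_d, moments2 p2 w & psum 3 v < psum 3 w <= psum 3 v + e.
Proof.
move=> d2 e0 hv [v0 v1 v2].
have [|[i [j [k [u vij vjk vk]]]]] := head_form_or_increasable hv d2; first by left.
right; have [y1 [y2 [y3 [z [/and3P[y10 y20 y30] /andP[z0 ze] E1 E2 E3]]]]] :=
  cubic_increase e0 vij vjk vk.
pose w := replace v [:: i; j; k] [:: y1; y2; y3].
(* Instantiated at each power, [S] turns [E1], [E2], [E3] into linear relations between the power
   sums of [v] and [w]. *)
have S g := @sum_replace R d v [:: i; j; k] [:: y1; y2; y3] g u erefl.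
have p1w : psum 1 w = psum 1 v.
  have := S (fun x => x ^+ 1); rewrite -!/(psum 1 _) -/w !big_cons !big_nil; lra.
have p2w : psum 2 w = psum 2 v.
  have := S (fun x => x ^+ 2); rewrite -!/(psum 2 _) -/w !big_cons !big_nil; lra.
have p3w : psum 3 w = psum 3 v + z.
  have := S (fun x => x ^+ 3); rewrite -!/(psum 3 _) -/w !big_cons !big_nil; lra.
exists w; last by rewrite p3w ltrDl z0 lerD2l.
split; rewrite ?p1w ?p2w //.
by apply: replace_ge0 => //=; rewrite y10 y20 y30.
Qed.

Lemma increase_psum4 p2 p3 v (e : R) : (2 <= d)%N -> 0 < e ->
  nneg_noninc v -> moments3 p2 p3 v ->
  max_form v \/
  exists2 w : 'rV[R]_d, moments3 p2 p3 w & psum 4 v < psum 4 w <= psum 4 v + e.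
Proof.
move=> d2 e0 hv [[v0 v1 v2] v3].
have [|[i [j [k [l [u vij vjk vkl vl]]]]]] := max_form_or_increasable hv d2.
  by left.
right; have [y1 [y2 [y3 [y4 [z [[ys0 /andP[z0 ze]] E1 E2 E3 E4]]]]]] :=
  quartic_increase e0 vij vjk vkl vl.
have /and4P[y10 y20 y30 y40] := ys0.
pose w := replace v [:: i; j; k; l] [:: y1; y2; y3; y4].
have S g := @sum_replace R d v [:: i; j; k; l] [:: y1; y2; y3; y4] g u erefl.
have p1w : psum 1 w = psum 1 v.
  have := S (fun x => x ^+ 1); rewrite -!/(psum 1 _) -/w !big_cons !big_nil; lra.
have p2w : psum 2 w = psum 2 v.
  have := S (fun x => x ^+ 2); rewrite -!/(psum 2 _) -/w !big_cons !big_nil; lra.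
have p3w : psum 3 w = psum 3 v.
  have := S (fun x => x ^+ 3); rewrite -!/(psum 3 _) -/w !big_cons !big_nil; lra.
have p4w : psum 4 w = psum 4 v + z.
  have := S (fun x => x ^+ 4); rewrite -!/(psum 4 _) -/w !big_cons !big_nil; lra.
exists w; last by rewrite p4w ltrDl z0 lerD2l.
split; last by rewrite /= p3w.
split; rewrite ?p1w ?p2w //.
by apply: replace_ge0 => //=; rewrite y10 y20 y30 y40.
Qed.

Lemma decrease_psum4 p2 p3 v : (2 <= d)%N ->
  nneg_noninc v -> moments3 p2 p3 v ->
  min_form v \/ exists2 w : 'rV[R]_d, moments3 p2 p3 w & psum 4 w < psum 4 v.
Proof.
move=> d2 hv [[v0 v1 v2] v3].
have [|[i [j [k [l [u vij vjk vkl vl]]]]]] := min_form_or_decreasable hv d2.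
  by left.
right; have [y1 [y2 [y3 [y4 [z [[/and4P[y10 y20 y30 y40] z0] E1 E2 E3 E4]]]]]] :=
  quartic_decrease vij vjk vkl vl.
pose w := replace v [:: i; j; k; l] [:: y1; y2; y3; y4].
have S g := @sum_replace R d v [:: i; j; k; l] [:: y1; y2; y3; y4] g u erefl.
have p1w : psum 1 w = psum 1 v.
  have := S (fun x => x ^+ 1); rewrite -!/(psum 1 _) -/w !big_cons !big_nil; lra.
have p2w : psum 2 w = psum 2 v.
  have := S (fun x => x ^+ 2); rewrite -!/(psum 2 _) -/w !big_cons !big_nil; lra.
have p3w : psum 3 w = psum 3 v.
  have := S (fun x => x ^+ 3); rewrite -!/(psum 3 _) -/w !big_cons !big_nil; lra.
have p4w : psum 4 w = psum 4 v + z.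
  have := S (fun x => x ^+ 4); rewrite -!/(psum 4 _) -/w !big_cons !big_nil; lra.
exists w; last by rewrite p4w gtrDl.
split; last by rewrite /= p3w.
split; rewrite ?p1w ?p2w //.
by apply: replace_ge0 => //=; rewrite y10 y20 y30 y40.
Qed.

Lemma ex_x4max p2 p3 : (2 <= d)%N -> moments3 p2 p3 !=set0 ->
  exists2 v : 'rV[R]_d, is_x4max 1 p2 p3 v &
    forall w : 'rV[R]_d, moments3 p2 p3 w -> psum 4 w <= psum 4 v.
Proof.
move=> d2 ne.
have [v mv vmax] := psum_argmax 4 (@closed_moments3 p2 p3) ne (@moments3_simplex p2 p3).
have [w [hw mw kw]] := moments3_sort mv.
(* Any gain contradicts maximality, so the cap 1 is arbitrary. *)
have [fw|[u mu /andP[wu _]]] := increase_psum4 d2 (@ltr01 R) hw mw.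
  exists w => [|u]; last by rewrite kw; exact: vmax.
  by split=> //; apply/moments3_has_psums.
by have := vmax u mu; rewrite -kw leNgt wu.
Qed.

Lemma ex_x4min p2 p3 : (2 <= d)%N -> moments3 p2 p3 !=set0 ->
  exists2 v : 'rV[R]_d, is_x4min 1 p2 p3 v &
    forall w : 'rV[R]_d, moments3 p2 p3 w -> psum 4 v <= psum 4 w.
Proof.
move=> d2 ne.
have [v mv vmin] := psum_argmin 4 (@closed_moments3 p2 p3) ne (@moments3_simplex p2 p3).
have [w [hw mw kw]] := moments3_sort mv.
have [fw|[u mu uw]] := decrease_psum4 d2 hw mw.
  exists w => [|u]; last by rewrite kw; exact: vmin.
  by split=> //; apply/moments3_has_psums.
by have := vmin u mu; rewrite -kw leNgt uw.
Qed.

Lemma x4max_unique p1 p2 p3 v w :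
  is_x4max p1 p2 p3 v -> is_x4max p1 p2 p3 w -> v = w.
Proof.
move=> [fv hv [v1 v2 v3]] [fw hw [w1 w2 w3]].
by apply: max_form_unique; rewrite ?v1 ?v2 ?v3.
Qed.

Lemma x4min_unique p1 p2 p3 v w :
  is_x4min p1 p2 p3 v -> is_x4min p1 p2 p3 w -> v = w.
Proof.
move=> [fv hv [v1 v2 v3]] [fw hw [w1 w2 w3]].
by apply: min_form_unique; rewrite ?v1 ?v2 ?v3.
Qed.

(** Uniqueness identifies [vmax] and [vmin] with the true extremizers. Conversely, starting from
    [vmin], the fourth power sum can be raised up to [p4]: a vector below [p4] that resists
    improvement sorts to [vmax], against [p4 <= psum 4 vmax]. *)
Lemma psum4_range p2 p3 (vmax vmin : 'rV[R]_d) (p4 : R) : (2 <= d)%N ->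
  is_x4max 1 p2 p3 vmax -> is_x4min 1 p2 p3 vmin ->
  (exists2 v : 'rV[R]_d, moments3 p2 p3 v & psum 4 v = p4) <->
  psum 4 vmin <= p4 <= psum 4 vmax.
Proof.
move=> d2 hmax hmin.
have mmin : moments3 p2 p3 vmin by case: hmin => _ h /(moments3_has_psums _ _ h).
have ne : moments3 p2 p3 !=set0 by exists vmin.
split=> [[v mv <-]|/andP[lo hi]].
  have [w /x4max_unique/(_ hmax) <- ->] := ex_x4max d2 ne => //.
  by have [u /x4min_unique/(_ hmin) <- ->] := ex_x4min d2 ne.
apply: psum_attained mmin lo _ => [||v mv vp4].
- exact: closed_moments3.
- exact: moments3_simplex.
have [w [hw mw kw]] := moments3_sort mv.
have e0 : 0 < p4 - psum 4 v by rewrite subr_gt0.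
have [fw|[u mu]] := increase_psum4 d2 e0 hw mw.
  have /x4max_unique/(_ hmax) E : is_x4max 1 p2 p3 w.
    by split=> //; apply/moments3_has_psums.
  by move: hi; rewrite -E kw leNgt vp4.
by rewrite kw addrC subrK => uv; exists u.
Qed.
End Extremals.

(** * Attaining the prescribed third power sum *)

Section ThirdMomentBounds.
Variables (R : realType) (d : nat).

Lemma psum_blocks (n k : nat) (x z : R) : (n < d)%N -> (0 < k)%N ->
  psum k (\row_(i < d) (if (i < n)%N then x else if i == n :> nat then z else 0))
    = n%:R * x ^+ k + z ^+ k.
Proof.
move=> nd k0; rewrite /psum.
pose F (i : nat) : R := if (i < n)%N then x ^+ k else if i == n then z ^+ k else 0.
rewrite (eq_bigr (fun i : 'I_d => F i)) => [|i _]; last first.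
  by rewrite mxE /F; do ![case: ifP => // _]; rewrite expr0n gtn_eqF.
rewrite -(big_mkord xpredT F) (@big_cat_nat _ _ _ n) //=; last exact: ltnW.
rewrite [X in X + _](eq_big_nat _ _ (F2 := fun=> x ^+ k)) => [|i /andP[_ lt]];
  last by rewrite /F lt.
rewrite sumr_const_nat subn0 mulr_natl; congr (_ + _).
rewrite big_ltn // /F ltnn eqxx big_nat big1 ?addr0 // => i /andP[ni _].
by rewrite ltnNge (ltnW ni) gtn_eqF.
Qed.

(** The witness has [alpha] entries [x], then the remainder [1 - alpha * x], then zeros; [x] is a
    root of the quadratic equation that fixes the second power sum. *)
Lemma p3_lower_attained (p2 : R) : (0 < d)%N -> 1 / d%:R <= p2 <= 1 ->
  exists2 v : 'rV[R]_d, moments2 p2 v & psum 3 v = p3_lower p2.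
Proof.
move=> d0 /andP[p2d p21].
have d0' : 0 < d%:R :> R by rewrite ltr0n.
have p20 : 0 < p2 by apply: lt_le_trans p2d; rewrite divr_gt0.
rewrite /p3_lower.
have fl0 : (0 <= Num.floor (1 / p2)) by rewrite floor_ge0 divr_ge0 // ltW.
have fl1 := floor_le (1 / p2); have fl2 := floorD1_gt (1 / p2).
case: (Num.floor (1 / p2)) fl0 fl1 fl2 => // n _; rewrite intrD -!pmulrn.
set al : R := n%:R => fl1 fl2.
have n1 : (1 <= n)%N.
  rewrite -(ltr_nat R) -(@ltrD2r _ 1) add0r; apply: le_lt_trans fl2.
  by rewrite ler_pdivlMr ?mul1r.
have al1 : 1 <= al by rewrite ler1n.
have p2al : al * p2 <= 1 by rewrite -ler_pdivlMr.
have p2al1 : 1 < (al + 1) * p2 by rewrite -ltr_pdivrMr.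
have nd : (n <= d)%N.
  rewrite -(ler_nat R); apply: (le_trans fl1).
  by rewrite ler_pdivrMr // -ler_pdivrMl // mulrC.
set s := Num.sqrt _; set x := (al + s) / _.
have arg0 : 0 <= al * (p2 * (al + 1) - 1) by apply: mulr_ge0; lra.
have s2 : s ^+ 2 = al * (p2 * (al + 1) - 1) by rewrite sqr_sqrtr.
have s0 : 0 <= s by exact: sqrtr_ge0.
have s1 : s <= 1.
  rewrite -(@ler_pXn2r _ 2) ?nnegrE // s2 expr1n.
  have : al * (al * p2) <= al * 1 by rewrite ler_pM2l //; lra.
  lra.
have den : al * (al + 1) != 0 by rewrite mulf_neq0 // gt_eqF //; lra.
have xE : al * (al + 1) * x = al + s by rewrite /x mulrC divfK.
have x0 : 0 <= x by rewrite /x divr_ge0 ?mulr_ge0 //; lra.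
(* The remainder is [(1 - s) / (al + 1)], so [s <= 1] makes it non-negative. *)
have zE : (al + 1) * (1 - al * x) = 1 - s by lra.
have z0 : 0 <= 1 - al * x.
  by rewrite -(@pmulr_rge0 _ (al + 1)) ?zE ?subr_ge0 //; lra.
have sq : al * x ^+ 2 + (1 - al * x) ^+ 2 = p2.
  have D0 : (al * (al + 1)) * (al * x ^+ 2 + (1 - al * x) ^+ 2) =
            (al * (al + 1)) * p2.
    have -> : (al * (al + 1)) * (al * x ^+ 2 + (1 - al * x) ^+ 2) =
      (al * (al + 1) * x) ^+ 2 - 2 * al * (al * (al + 1) * x) + al * (al + 1).
      by ring.
    by rewrite xE; have -> : (al + s) ^+ 2 = al ^+ 2 + 2 * al * s + s ^+ 2
      by [ring]; rewrite s2; ring.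
  exact: (mulfI den).
pose v : 'rV[R]_d := \row_(i < d)
  (if (i < n)%N then x else if i == n :> nat then 1 - al * x else 0).
have pv k : (0 < k)%N -> psum k v = al * x ^+ k + (1 - al * x) ^+ k.
  (* When [n = d] no position is left for the remainder, but then [p2] is [1 / d], [s] is 1 and the
     remainder is zero. *)
  move=> k0; move: nd; rewrite leq_eqVlt => /orP[/eqP nd|nd]; last exact: psum_blocks.
  have z : 1 - al * x = 0.
    have alp : al * p2 = 1.
      apply/eqP; rewrite eq_le p2al /= -ler_pdivrMl ?mulr1; last by lra.
      by rewrite /al nd -[_^-1]mul1r.
    have s11 : s = 1.
      apply/eqP; rewrite -(@eqrXn2 _ 2) // s2 expr1n; apply/eqP.
      have : al * (al * p2) = al by rewrite alp mulr1.
      lra.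
    apply: (@mulfI _ (al + 1)); first by rewrite gt_eqF //; lra.
    by rewrite zE s11 subrr mulr0.
  rewrite z expr0n gtn_eqF // addr0 /psum (eq_bigr (fun=> x ^+ k)) => [|i _].
    by rewrite sumr_const card_ord mulr_natl /al nd.
  by rewrite mxE nd ltn_ord.
exists v; last by rewrite pv.
split=> [i||]; rewrite ?pv ?sq // ?expr1; last by ring.
by rewrite mxE; do ![case: ifP => // _].
Qed.

Lemma psum_head (k : nat) (a b : R) : (0 < d)%N ->
  psum k (\row_(i < d) (if i == 0%N :> nat then a else b))
    = a ^+ k + (d%:R - 1) * b ^+ k.
Proof.
case: d => // n _; rewrite /psum big_ord_recl mxE /=; congr (_ + _).
rewrite (eq_bigr (fun=> b ^+ k)) => [|i _]; last by rewrite mxE.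
by rewrite sumr_const card_ord -addn1 natrD addrK mulr_natl.
Qed.

(** The first two power sums leave a quadratic equation for [b]. Since [b <= a] gives [D * b <= 1],
    the square root is [(D - 1) * (1 - D * b)], and [b] is the root [y] with the minus sign. *)
Lemma psum3_head_form (p2 : R) (v : 'rV[R]_d) : (2 <= d)%N ->
  nneg_noninc v -> moments2 p2 v ->
  (exists a b : R, v = \row_(i < d) (if i == 0%N :> nat then a else b)) ->
  psum 3 v = p3_upper d p2.
Proof.
move=> d2 hv [v0 v1 v2] [a [b vE]]; have d0 := ltnW d2.
have ba : b <= a.
  by have := hv.2 (Ordinal d0) (Ordinal d2) isT; rewrite vE !mxE.
move: v1 v2; rewrite vE !psum_head // !expr1 => v1 v2.
have dgt : 2 <= d%:R :> R by rewrite ler_nat.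
rewrite /p3_upper.
set D : R := d%:R in dgt v1 v2 *.
have aE : a = 1 - (D - 1) * b by lra.
have -> : Num.sqrt ((D - 1) * (p2 * D - 1)) = (D - 1) * (1 - D * b).
  have -> : (D - 1) * (p2 * D - 1) = ((D - 1) * (1 - D * b)) ^+ 2.
    by rewrite -v2 aE; ring.
  rewrite sqrtr_sqr ger0_norm // mulr_ge0 //; lra.
have -> : (D - 1 - (D - 1) * (1 - D * b)) / (D * (D - 1)) = b.
  by field; apply/andP; split; rewrite gt_eqF //; lra.
by rewrite -aE.
Qed.

(** Raise the third power sum from [p3_lower p2] by cubic shifts; only vectors of the form
    [(a, b, ..., b)] block this, and these already reach [p3_upper d p2]. *)
Lemma moments3_nonempty (p2 p3 : R) : (2 <= d)%N -> 1 / d%:R <= p2 <= 1 ->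
  p3_lower p2 <= p3 <= p3_upper d p2 -> exists v : 'rV[R]_d, moments3 p2 p3 v.
Proof.
move=> d2 hp2 /andP[lo hi].
have [v0 mv0 v03] := p3_lower_attained (ltnW d2) hp2.
rewrite -v03 in lo.
have [||v mv v3] := psum_attained (@closed_moments2 R d p2) _ mv0 lo.
- by move=> v [].
- move=> v mv vp3; have [w [hw mw kw]] := moments2_sort mv.
  have e0 : 0 < p3 - psum 3 v by rewrite subr_gt0.
  have [fw|[u mu]] := increase_psum3 d2 e0 hw mw; last first.
    by rewrite kw addrC subrK => uv; exists u.
  by move: hi; rewrite -(psum3_head_form d2 hw mw fw) kw leNgt vp3.
by exists v.
Qed.
End ThirdMomentBounds.

Theorem mainTheorem3 (R : realType) (dA dB d : nat) (p1 p2 p3 : R)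
  (hd : d = (dA * dB)%N) (hd2 : (2 <= d)%N)
  (hp1 : p1 = 1)
  (hp2 : 1 / d%:R <= p2 <= 1)
  (hp3 : p3_lower p2 <= p3 <= p3_upper d p2) :
  [/\ exists! v : 'rV[R]_d, is_x4max p1 p2 p3 v,
      exists! v : 'rV[R]_d, is_x4min p1 p2 p3 v
    & forall x4max x4min : 'rV[R]_d,
        is_x4max p1 p2 p3 x4max -> is_x4min p1 p2 p3 x4min ->
        forall p4 : R,
          (exists rho : 'M[R[i]]_(dA * dB),
             [/\ separable_state rho,
                 p1%:C = \tr (ptransposeA rho ^+ 1),
                 p2%:C = \tr (ptransposeA rho ^+ 2),
                 p3%:C = \tr (ptransposeA rho ^+ 3)
               & p4%:C = \tr (ptransposeA rho ^+ 4)])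
          <-> psum 4 x4min <= p4 <= psum 4 x4max].
Proof.
subst p1; have ne := moments3_nonempty hd2 hp2 hp3; split.
- have [v hv _] := ex_x4max hd2 ne.
  by exists v; split=> // w; exact: x4max_unique.
- have [v hv _] := ex_x4min hd2 ne.
  by exists v; split=> // w; exact: x4min_unique.
move=> x4max x4min hmax hmin p4.
(* The interval condition becomes the existence of a probability vector with the prescribed power
   sums. *)
rewrite -(psum4_range p4 hd2 hmax hmin) => {ne hmax hmin x4max x4min hp3 hp2}.
(* The entry at index 0 is a placeholder: only orders 1 to 4 are selected. *)
subst d; pose p (k : nat) := nth 0 [:: 0; 1; p2; p3; p4] k.
have M := @separable_moments R dA dB p (fun k => 0 < k <= 4)%N isT erefl.
split.
  move=> [rho [sep t1 t2 t3 t4]]; have [|x [x0 xp]] := M.1.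
    by exists rho; split=> //; case=> [|[|[|[|[|k]]]]].
  exists x; last exact: (xp 4%N).
  split; last exact: (xp 3%N).
  by split=> //; [exact: (xp 1%N)|exact: (xp 2%N)].
move=> [x [[x0 x1 x2] x3] x4].
have [|rho [sep rp]] := M.2.
  exists x; split=> //; case=> [|[|[|[|[|k]]]]] // _.
exists rho; split=> //.
- exact: (rp 1%N).
- exact: (rp 2%N).
- exact: (rp 3%N).
- exact: (rp 4%N).
Qed.
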